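(* Let $H=(V,E)$ be the hexagonal graph, $X\subset V$ a simple domain and $a\in\partial X$ a border edge of $X$. Let $\zeta=\exp(2\pi i/6)$. Then in $\mathbb{C}[y,y^{-1}][[x]]$ the following formal identity holds: $$\sum_{e\in\partial X}\ell(\overline{e})\,y^{r(e)}F_{a,e}(x)=\left(1+x\zeta^{-2}y+x\zeta^{2}y^{-1}\right)\sum_{w\in S}\ell(w)\,y^{r(w)}x^{|w|}+\left(\zeta^{2}y^{-4}+\zeta^{-2}y^{4}\right)\sum_{w\in S,\;C\in C(w)}\ell(w)\,y^{r(w)}x^{|w|+|C|},$$ where $S$ is the set of all self-avoiding walks (SAWs) that start in $a$ (that is, their first edge is $a$ and their first vertex is the endvertex of $a$ not in $X$) and have all vertices but the first in $X$, and $C(w)$ is the set of all cycles in $X$ that intersect $w$ only in its final vertex.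
   Context: **Hexagonal graph.** $H=(V,E)$ is the plane graph with $V=\mathbb{Z}\times\mathbb{Z}\subset\mathbb{R}^2$, whose edges are all vertical unit segments $(p,q)(p,q+1)$ and those horizontal unit segments $(p,q)(p+1,q)$ with $p\equiv q \pmod 2$. It is a cubic graph isomorphic to the hexagonal lattice graph. For $v\in V$, $N(v)$ denotes the set of three edges incident with $v$. **Walks.** A walk in $H$ is a sequence $w=(v_1,e_1,v_2,e_2,\dots,e_n,v_{n+1})$ with $n\ge 1$, $e_j=v_jv_{j+1}\in E$ and $e_j\neq e_{j+1}$ (no backtracks); $|w|=n$ is its length, and its final edge is $f(w)=e_n$. A self-avoiding walk (SAW) is a walk with all $v_j$ distinct. A closed SAW is a walk in which $v_1=v_{n+1}$ is the only equality among vertices. A weak SAW is a walk in which all $v_j$ are distinct except that possibly $v_{n+1}=v_j$ for some $j\le n$. **Domains.** A domain is a finite or infinite connected set $X\subset V$ of vertices. It is simple if every connected component of the subgraph $H\backslash X$ induced by $H$ on $V\backslash X$ is infinite. $E(X)$ is the set of edges with at least one endvertex in $X$, and $\partial X\subset E(X)$ (the border edges) is the set of edges with exactly one endvertex in $X$. A cycle $C$ in $X$ is a $2$-regular connected subgraph of $H$ with all vertices in $X$; $|C|$ is its number of edges. **Generating functions.** For $a\in\partial X$ and $e\in E(X)$, $X(a,e)$ is the set of all weak SAWs $w=(v_1,e_1,\dots,e_n,v_{n+1})$ such that $e_1=a$, $v_1$ is the endvertex of $a$ not in $X$, $e_n=e$, and $v_j\notin X$ implies $j=1$ or $j=n+1$.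 Put $F_{a,e}(x)=\sum_{w\in X(a,e)}x^{|w|}$ (so $F_{a,a}(x)=x$). **Directions $\ell$.** An oriented edge is a pair $(e,v)$ with $v$ an endvertex of $e$, thought of as $e$ oriented away from $v$. The basic orientation of an edge is left-to-right (horizontal edges) or bottom-to-top (vertical edges). Let $\ell_b(e)=1$ for horizontal $e$, and for vertical $e$ let $\ell_b(e)=\zeta$ (resp. $\zeta^2$) if the top vertex of $e$ is incident with a horizontal edge going to the right (resp. to the left). Put $\ell(e,v)=\ell_b(e)$ if $(e,v)$ is oriented as in the basic orientation and $\ell(e,v)=-\ell_b(e)$ otherwise. For $e\in\partial X$, $\overline{e}$ denotes $e$ oriented away from its endvertex in $X$, so $\ell(\overline e)=\ell(e,v)$ with $v$ the endvertex of $e$ in $X$. For a walk $w$ with final vertex $v_{n+1}$ and final edge $e_n$, $\ell(w)=\ell(e_n,v_{n+1})$, i.e. the final edge is oriented oppositely to the direction of the walk. **Winding number $r$.** A hook is a SAW $(v_1,e_1,v_2,e_2,v_3)$ of length $2$. It is a left hook, of weight $+1$, if it turns left (i.e. $e_2$ comes immediately clockwise after $e_1$ around $v_2$), and a right hook, of weight $-1$, if it turns right ($e_2$ comes immediately counter-clockwise after $e_1$). For a walk $w=(v_1,e_1,\dots,e_n,v_{n+1})$, $r(w)\in\mathbb{Z}$ is the sum of the weights of the hooks $(v_i,e_i,v_{i+1},e_{i+1},v_{i+2})$, $1\le i\le n-1$ (so $r(w)=0$ if $|w|=1$). For a simple domain $X$ and fixed $a,e\in\partial X$, all walks $w\in X(a,e)$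 have the same winding number, and $r(e)$ denotes this common value $r(w)$. *)

(* Defs.v *)
(* Written on top of MathComp and MathComp-Analysis. *)
From HB Require Import structures.
From mathcomp Require Import all_boot all_order all_algebra finmap complex.
From mathcomp Require Import all_classical all_reals all_analysis.

Set Implicit Arguments.
Unset Strict Implicit.
Unset Printing Implicit Defensive.

Import Order.TTheory GRing.Theory Num.Theory.
Local Open Scope ring_scope.
Local Open Scope classical_set_scope.

(** * Laurent polynomials F[y, y^-1] *)

(* F[y, y^-1] is realised as the localization of F[y] at the powers of y,
   i.e. as the subring of F(y) of the fractions p(y) / y^n. *)
Section Laurent.
Variable F : fieldType.
Local Notation FX := {fraction {poly F}}.

Definition laurent_pred (f : FX) : bool :=
  `[< exists (p : {poly F}) (n : nat), f = tofrac p / tofrac 'X ^+ n >].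

Let X_neq0 : tofrac 'X != 0 :> FX.
Proof. by rewrite tofrac_eq0 polyX_eq0. Qed.

Lemma laurent_pred_poly p : laurent_pred (tofrac p).
Proof. by apply/asboolP; exists p, 0%N; rewrite expr0 divr1. Qed.

Let frac_sub (K : fieldType) (i : {rmorphism {poly F} -> K}) p q n m :
  i 'X != 0 -> i p / i 'X ^+ n - i q / i 'X ^+ m =
               i (p * 'X^m - q * 'X^n) / i 'X ^+ (n + m).
Proof.
move=> X0; rewrite -mulNr addf_div ?expf_neq0//.
by rewrite rmorphB !rmorphM !rmorphXn exprD mulNr.
Qed.

Let frac_mul (K : fieldType) (i : {rmorphism {poly F} -> K}) p q n m :
  (i p / i 'X ^+ n) * (i q / i 'X ^+ m) = i (p * q) / i 'X ^+ (n + m).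
Proof. by rewrite rmorphM exprD mulf_div. Qed.

Lemma laurent_subring_closed : subring_closed laurent_pred.
Proof.
split.
- by rewrite -tofrac1; apply: laurent_pred_poly.
- move=> _ _ /asboolP[p [n ->]] /asboolP[q [m ->]]; apply/asboolP.
  exists (p * 'X^m - q * 'X^n), (n + m)%N.
  exact: (@frac_sub FX (@tofrac {poly F}) p q n m X_neq0).
- move=> _ _ /asboolP[p [n ->]] /asboolP[q [m ->]]; apply/asboolP.
  exists (p * q), (n + m)%N.
  exact: (@frac_mul FX (@tofrac {poly F}) p q n m).
Qed.

HB.instance Definition _ :=
  GRing.isSubringClosed.Build FX laurent_pred laurent_subring_closed.

Record laurent := Laurent { laurent_val : FX; _ : laurent_val \in laurent_pred }.

HB.instance Definition _ := [isSub for laurent_val].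
HB.instance Definition _ := [Choice of laurent by <:].
HB.instance Definition _ := [SubChoice_isSubComNzRing of laurent by <:].

Definition laurent_unit : {pred laurent} :=
  [pred f | (val f != 0) && ((val f)^-1 \in laurent_pred)].

Definition laurent_inv (f : laurent) : laurent := insubd f (val f)^-1.

Lemma laurent_mulVx : {in laurent_unit, left_inverse 1 laurent_inv *%R}.
Proof.
move=> f /andP[f0 fV]; apply: val_inj.
by rewrite rmorphM rmorph1 /= val_insubd fV mulVf.
Qed.

Lemma laurent_unitPl (f g : laurent) : g * f = 1 -> laurent_unit f.
Proof.
move/(congr1 val); rewrite rmorphM rmorph1 /= => gf1.
have f0 : val f != 0.
  by apply: contra_eq_neq gf1 => ->; rewrite mulr0 eq_sym oner_eq0.
apply/andP; split=> //.
suff -> : (val f)^-1 = val g by exact: valP.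
by apply: (mulIf f0); rewrite mulVf.
Qed.

Lemma laurent_invr_out : {in [predC laurent_unit], laurent_inv =1 id}.
Proof.
move=> f; rewrite inE negb_and negbK => /orP[/eqP f0|fV]; apply: val_inj.
  by rewrite val_insubd f0 invr0 if_same.
by rewrite val_insubd (negbTE fV).
Qed.

HB.instance Definition _ := GRing.ComNzRing_hasMulInverse.Build laurent
  laurent_mulVx laurent_unitPl laurent_invr_out.

Definition laurentP (p : {poly F}) : laurent := Laurent (laurent_pred_poly p).

Lemma laurentP_is_zmod_morphism : zmod_morphism laurentP.
Proof. by move=> p q; apply: val_inj; rewrite raddfB /= tofracB. Qed.

Lemma laurentP_is_monoid_morphism : monoid_morphism laurentP.
Proof.
by split=> [|p q]; apply: val_inj; rewrite ?rmorph1 ?rmorphM /= ?tofrac1 ?tofracM.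
Qed.

HB.instance Definition _ :=
  GRing.isZmodMorphism.Build {poly F} laurent laurentP laurentP_is_zmod_morphism.
HB.instance Definition _ :=
  GRing.isMonoidMorphism.Build {poly F} laurent laurentP
    laurentP_is_monoid_morphism.

Definition laurent_scale (c : F) (f : laurent) : laurent := laurentP c%:P * f.

Lemma laurent_scaleA a b f :
  laurent_scale a (laurent_scale b f) = laurent_scale (a * b) f.
Proof. by rewrite /laurent_scale mulrA -rmorphM /= -polyCM. Qed.
Lemma laurent_scale1 : left_id 1 laurent_scale.
Proof. by move=> f; rewrite /laurent_scale polyC1 rmorph1 mul1r. Qed.
Lemma laurent_scaleDr : right_distributive laurent_scale +%R.
Proof. by move=> a f g; rewrite /laurent_scale mulrDr. Qed.
Lemma laurent_scaleDl f : {morph laurent_scale^~ f : a b / a + b}.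
Proof. by move=> a b; rewrite /laurent_scale polyCD rmorphD /= mulrDl. Qed.

HB.instance Definition _ := GRing.Zmodule_isLmodule.Build F laurent
  laurent_scaleA laurent_scale1 laurent_scaleDr laurent_scaleDl.

Lemma laurent_scaleAl (a : F) (f g : laurent) : a *: (f * g) = (a *: f) * g.
Proof. exact: mulrA. Qed.

HB.instance Definition _ :=
  GRing.Lmodule_isLalgebra.Build F laurent laurent_scaleAl.
HB.instance Definition _ := GRing.Lalgebra_isComAlgebra.Build F laurent.

Definition laurentY : laurent := laurentP 'X.

(* So the powers [laurentY ^ k], [k : int], are the genuine monomials y^k. *)
Lemma laurentY_unit : laurentY \is a GRing.unit.
Proof.
rewrite unfold_in /= /laurent_unit inE /=; rewrite X_neq0 /=.
by apply/asboolP; exists 1, 1%N; rewrite expr1 tofrac1 mul1r.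
Qed.

End Laurent.

(** * Formal power series A[[x]] *)

Record fps (A : Type) := Fps { fps_coef : nat -> A }.

Section FPS.
Variable A : comNzRingType.
Implicit Types f g h : fps A.
Local Notation "f `# n" := (fps_coef f n) (at level 2).

HB.instance Definition _ := gen_eqMixin (fps A).
HB.instance Definition _ := gen_choiceMixin (fps A).

Lemma fpsP f g : (forall n, f `# n = g `# n) <-> f = g.
Proof.
split=> [fg|-> //]; case: f g fg => [f] [g] /= fg.
by congr Fps; apply/funext.
Qed.

Definition fps_zero : fps A := Fps (fun=> 0).
Definition fps_opp f : fps A := Fps (fun n => - f `# n).
Definition fps_add f g : fps A := Fps (fun n => f `# n + g `# n).
Definition fps_one : fps A := Fps (fun n => (n == 0%N)%:R).
Definition fps_mul f g : fps A :=
  Fps (fun n => \sum_(i < n.+1) f `# i * g `# (n - i)).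

Lemma fps_addA : associative fps_add.
Proof. by move=> f g h; apply/fpsP => n; apply: addrA. Qed.
Lemma fps_addC : commutative fps_add.
Proof. by move=> f g; apply/fpsP => n; apply: addrC. Qed.
Lemma fps_add0 : left_id fps_zero fps_add.
Proof. by move=> f; apply/fpsP => n; apply: add0r. Qed.
Lemma fps_addN : left_inverse fps_zero fps_opp fps_add.
Proof. by move=> f; apply/fpsP => n; apply: addNr. Qed.

HB.instance Definition _ :=
  GRing.isZmodule.Build (fps A) fps_addA fps_addC fps_add0 fps_addN.

Let trunc n f : {poly A} := \poly_(i < n.+1) f `# i.

Let mul_trunc f g n m : (n <= m)%N ->
  (fps_mul f g) `# n = (trunc m f * trunc m g)`_n.
Proof.
move=> nm; rewrite coefM; apply: eq_bigr => i _.
rewrite !coef_poly !ltnS (leq_trans (leq_subr _ _) nm).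
by rewrite (leq_trans _ nm)// -ltnS.
Qed.

Lemma fps_mulC : commutative fps_mul.
Proof.
by move=> f g; apply/fpsP => n; rewrite !(@mul_trunc _ _ n n)// mulrC.
Qed.

Lemma fps_mulA : associative fps_mul.
Proof.
move=> f g h; apply/fpsP => n.
transitivity (trunc n f * (trunc n g * trunc n h))`_n.
  rewrite coefM /=; apply: eq_bigr => i _.
  rewrite coef_poly ltn_ord; congr (_ * _).
  by rewrite -mul_trunc ?leq_subr.
rewrite mulrA coefM /=; apply: eq_bigr => i _.
by rewrite coef_poly ltnS leq_subr -mul_trunc // -ltnS.
Qed.

Lemma fps_mul1 : left_id fps_one fps_mul.
Proof.
move=> f; apply/fpsP => n /=.
rewrite big_ord_recl /= mul1r subn0 big1 ?addr0// => i _.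
by rewrite /= mul0r.
Qed.

Lemma fps_mulDl : left_distributive fps_mul +%R.
Proof.
move=> f g h; apply/fpsP => n /=; rewrite -big_split /=.
by apply: eq_bigr => i _; rewrite mulrDl.
Qed.

Lemma fps_1neq0 : fps_one != 0.
Proof.
apply/eqP => /(congr1 (fun f => f `# 0)) /= /eqP; exact/negP/oner_neq0.
Qed.

HB.instance Definition _ := GRing.Zmodule_isComNzRing.Build (fps A)
  fps_mulA fps_mulC fps_mul1 fps_mulDl fps_1neq0.

Definition fps_scale (c : A) f : fps A := Fps (fun n => c * f `# n).

Lemma fps_scaleA a b f : fps_scale a (fps_scale b f) = fps_scale (a * b) f.
Proof. by apply/fpsP => n; apply: mulrA. Qed.
Lemma fps_scale1 : left_id 1 fps_scale.
Proof. by move=> f; apply/fpsP => n; apply: mul1r. Qed.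
Lemma fps_scaleDr : right_distributive fps_scale +%R.
Proof. by move=> a f g; apply/fpsP => n; apply: mulrDr. Qed.
Lemma fps_scaleDl f : {morph fps_scale^~ f : a b / a + b}.
Proof. by move=> a b; apply/fpsP => n; apply: mulrDl. Qed.

HB.instance Definition _ := GRing.Zmodule_isLmodule.Build A (fps A)
  fps_scaleA fps_scale1 fps_scaleDr fps_scaleDl.

Lemma fps_scaleAl (a : A) f g : a *: (f * g) = (a *: f) * g.
Proof.
apply/fpsP => n /=; rewrite big_distrr /=.
by apply: eq_bigr => i _; rewrite mulrA.
Qed.

HB.instance Definition _ :=
  GRing.Lmodule_isLalgebra.Build A (fps A) fps_scaleAl.
HB.instance Definition _ := GRing.Lalgebra_isComAlgebra.Build A (fps A).

Definition fpsX : fps A := Fps (fun n => (n == 1%N)%:R).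

(* The sum of a locally finite family of power series: for every n, the
   coefficient of x^n must be non-zero for only finitely many indices.  This
   holds for all families of walks considered below, a vertex being the start
   of only finitely many walks of length n. *)
Definition fps_sum (I : choiceType) (D : set I) (f : I -> fps A) : fps A :=
  Fps (fun n => \sum_(i \in D) (f i) `# n).

End FPS.

Notation "'\fps_sum_' ( i 'in' D ) f" := (fps_sum D (fun i => f))
  (at level 41, f at level 41, i, D at level 50,
   format "'[' '\fps_sum_' ( i  'in'  D ) '/  '  f ']'") : ring_scope.

(** * The hexagonal graph *)

Definition vertex : Type := (int * int)%type.
HB.instance Definition _ := Choice.on vertex.

Definition above (v : vertex) : vertex := (v.1, v.2 + 1).
Definition below (v : vertex) : vertex := (v.1, v.2 - 1).
Definition right_of (v : vertex) : vertex := (v.1 + 1, v.2).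
Definition left_of (v : vertex) : vertex := (v.1 - 1, v.2).

(* The horizontal edge at v goes to the right of v. *)
Definition even_vertex (v : vertex) : bool := (v.1 == v.2 %[mod 2])%Z.

(* An edge is the pair of its endvertices, listed according to its basic
   orientation (bottom-to-top or left-to-right). *)
Definition edge : Type := (vertex * vertex)%type.
HB.instance Definition _ := Choice.on edge.

Definition vertical (e : edge) : bool := e.2 == above e.1.
Definition horizontal (e : edge) : bool :=
  even_vertex e.1 && (e.2 == right_of e.1).
Definition is_edge (e : edge) : bool := vertical e || horizontal e.

Definition endvertex (v : vertex) (e : edge) : bool := (v == e.1) || (v == e.2).

(* The edge uv of H, when u and v are adjacent. *)
Definition edge_between (u v : vertex) : edge :=
  if is_edge (u, v) then (u, v) else (v, u).

Definition adj (u v : vertex) : bool := is_edge (edge_between u v).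

(** * Walks *)

(* A walk (v_1, e_1, v_2, ..., e_n, v_{n+1}) is represented by the sequence
   of its vertices, which determines its edges; [nth_vertex w i] is v_{i+1}. *)
Definition nth_vertex (w : seq vertex) (i : nat) : vertex :=
  nth ((0, 0) : vertex) w i.

Definition first_vertex (w : seq vertex) : vertex := nth_vertex w 0.
Definition final_vertex (w : seq vertex) : vertex := nth_vertex w (size w).-1.

Definition walk_edges (w : seq vertex) : seq edge :=
  pairmap edge_between (first_vertex w) (behead w).

Definition walk_length (w : seq vertex) : nat := size (walk_edges w).

Definition first_edge (w : seq vertex) : edge :=
  edge_between (first_vertex w) (nth_vertex w 1).
Definition final_edge (w : seq vertex) : edge :=
  edge_between (nth_vertex w (size w).-2) (final_vertex w).

Definition walk (w : seq vertex) : bool :=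
  [&& (1 <= walk_length w)%N, sorted adj w
    & sorted (fun e f => e != f) (walk_edges w)].

Definition SAW (w : seq vertex) : bool := walk w && uniq w.

(* v_1, ..., v_n are distinct, v_{n+1} is unrestricted. *)
Definition weak_SAW (w : seq vertex) : bool :=
  walk w && uniq (take (walk_length w) w).

(** * Winding number *)

(* The three neighbours of v in clockwise order around v. *)
Definition cw_neighbours (v : vertex) : seq vertex :=
  if even_vertex v then [:: above v; right_of v; below v]
  else [:: above v; below v; left_of v].

(* The weight of the hook with vertices u, v, t: it turns left when the edge
   vt comes immediately clockwise after the edge uv around v. *)
Definition hook_weight (u v t : vertex) : int :=
  if t == next (cw_neighbours v) u then 1 else -1.

Definition winding (w : seq vertex) : int :=
  \sum_(i < (walk_length w).-1)
    hook_weight (nth_vertex w i) (nth_vertex w i.+1) (nth_vertex w i.+2).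

(** * Domains *)

Definition reachable (A : set vertex) (u v : vertex) : Prop :=
  exists p : seq vertex,
    [/\ path adj u p, last u p = v & forall t, t \in u :: p -> A t].

Definition connected_in_H (A : set vertex) : Prop :=
  forall u v, A u -> A v -> reachable A u v.

Definition component_in_H (A : set vertex) (u : vertex) : set vertex :=
  [set v | reachable A u v].

Definition domain (X : set vertex) : Prop := X !=set0 /\ connected_in_H X.

Definition simple_domain (X : set vertex) : Prop :=
  domain X /\ forall u, (~` X) u -> infinite_set (component_in_H (~` X) u).

Definition border (X : set vertex) : set edge :=
  [set e | is_edge e /\ ((X e.1 /\ ~ X e.2) \/ (~ X e.1 /\ X e.2))].

(* The set X(a, e). *)
Definition domain_walks (X : set vertex) (a e : edge) : set (seq vertex) :=
  [set w | [/\ weak_SAW w, first_edge w = a, ~ X (first_vertex w),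
               final_edge w = e
             & forall i, (i < size w)%N -> ~ X (nth_vertex w i) ->
                 i = 0%N \/ i = (size w).-1]].

(* The set S. *)
Definition domain_SAWs (X : set vertex) (a : edge) : set (seq vertex) :=
  [set w | [/\ SAW w, first_edge w = a, ~ X (first_vertex w)
             & forall v, v \in behead w -> X v]].

(* The common winding number r(e) of the walks in X(a, e). *)
Definition border_winding (X : set vertex) (a e : edge) : int :=
  xget 0 [set winding w | w in domain_walks X a e].

(** * Cycles *)

(* A finite subgraph of H: its vertices and its edges. *)
Definition subgraph : Type := ({fset vertex} * {fset edge})%type.
HB.instance Definition _ := Choice.on subgraph.

Definition is_subgraph (C : subgraph) : Prop :=
  forall e, e \in C.2 -> [/\ is_edge e, e.1 \in C.1 & e.2 \in C.1].

Definition two_regular (C : subgraph) : Prop :=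
  forall v, v \in C.1 -> #|` [fset e in C.2 | endvertex v e]%fset| = 2%N.

Definition connected_subgraph (C : subgraph) : Prop :=
  C.1 != fset0 /\
  forall u v, u \in C.1 -> v \in C.1 ->
    exists p : seq vertex,
      path (fun s t => edge_between s t \in C.2) u p /\ last u p = v.

Definition cycle_in (X : set vertex) (C : subgraph) : Prop :=
  [/\ is_subgraph C, two_regular C, connected_subgraph C
    & forall v, v \in C.1 -> X v].

(* The set C(w). *)
Definition tail_cycles (X : set vertex) (w : seq vertex) : set subgraph :=
  [set C | cycle_in X C /\
     forall v, (v \in C.1) && (v \in w) = (v == final_vertex w)].

(** * The weights *)

Section Weights.
Variable R : realType.

(* exp(2 pi i / 6) *)
Definition zeta : R[i] := (cos (2 * pi / 6) +i* sin (2 * pi / 6))%C.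

(* The horizontal edge at the top vertex [e.2] of a vertical edge goes to the
   right if [even_vertex e.2], to the left otherwise. *)
Definition ell_basic (e : edge) : R[i] :=
  if horizontal e then 1 else if even_vertex e.2 then zeta else zeta ^+ 2.

(* e is oriented away from its endvertex v. *)
Definition ell (e : edge) (v : vertex) : R[i] :=
  if v == e.1 then ell_basic e else - ell_basic e.

Definition ell_walk (w : seq vertex) : R[i] :=
  ell (final_edge w) (final_vertex w).

Definition inner_endvertex (X : set vertex) (e : edge) : vertex :=
  if `[< X e.1 >] then e.1 else e.2.

(* The direction of a border edge oriented away from its endvertex in X. *)
Definition ell_border (X : set vertex) (e : edge) : R[i] :=
  ell e (inner_endvertex X e).

Local Notation x := (fpsX (laurent R[i])).

Definition walk_gf (X : set vertex) (a e : edge) : fps (laurent R[i]) :=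
  \fps_sum_(w in domain_walks X a e) x ^+ walk_length w.

End Weights.

(* Main.v *)
Require Import Defs.
From HB Require Import structures.
From mathcomp Require Import all_boot all_order all_algebra finmap complex.
From mathcomp Require Import all_classical all_reals all_analysis.
From mathcomp Require Import zify ring.

Set Implicit Arguments.
Unset Strict Implicit.
Unset Printing Implicit Defensive.

Import Order.TTheory GRing.Theory Num.Theory.
Local Open Scope ring_scope.
Local Open Scope classical_set_scope.

(* Write v for the final vertex of a walk w in S, and f w for l(w) y^r(w), so that
   f w = l(a) (zeta y)^r(w).  Multiplying f w by zeta^-2 y or zeta^2 y^-1 gives -f of
   the extension of w by a left or a right turn at v, because zeta^3 = -1.  These
   extensions are all the weak self-avoiding walks of length at least 2, so in the
   first term of the right-hand side the walks of S cancel; what remains are the walks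
   that leave X, which make up the left-hand side, and the walks w' that close up a
   cycle C at the final vertex of some w in S.  The latter come in pairs (the two
   orientations of C), whose winding numbers are r(w) - 4 (left turn first) and
   r(w) + 4 (right turn first), which is the second term.

   The two topological facts (r(w) depends only on the final border edge; a cycle turns
   by -6 or 6 in total, with the sign given by the side from which it is entered) follow
   from a discrete version of Hopf's Umlaufsatz.  With the vertices in Z x Z, the turning
   of a walk is determined by how often the secant v_j - v_i crosses the ray x > 0,
   y = -1/2 along the diagonal of the triangle i < j.  No elementary square of the
   triangle contributes, because no secant vanishes, so the diagonal may be pushed to
   the two other sides, where one counts the crossings of the walk seen from each of its
   endpoints.  For a loop, this count is an index, which does not change while the
   viewpoint moves off the loop and which vanishes far away.  Since X is simple, a
   viewpoint outside X can be moved arbitrarily far without meeting X. *)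

(** * Crossings of a ray *)

Definition vec (p q : vertex) : int * int := (q.1 - p.1, q.2 - p.2).

(* The signed crossing of the ray x > 0, y = -1/2 by the unit step from d to d'. *)
Definition ray (d d' : int * int) : int :=
  if (0 < d.1) && (0 < d'.1) then (d.2 < 0)%R%:Z - (d'.2 < 0)%R%:Z else 0.

Lemma vertexE (u v : vertex) : (u == v) = (u.1 == v.1) && (u.2 == v.2).
Proof. by case: u v => [? ?] [? ?]; rewrite xpair_eqE. Qed.

Definition unit_step (u v : vertex) : bool :=
  ((v.1 == u.1) && ((v.2 == u.2 + 1) || (u.2 == v.2 + 1))) ||
  ((v.2 == u.2) && ((v.1 == u.1 + 1) || (u.1 == v.1 + 1))).

Ltac decide_ifs := repeat (rewrite ?xpair_eqE /=;
  match goal with |- context[if ?c then _ else _] =>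
  first [have -> : c = true by lia | have -> : c = false by lia] end).

Lemma unit_stepP u v : unit_step u v ->
  exists2 s, v = (u.1 + s.1, u.2 + s.2) & s \in [:: (1,0);(-1,0);(0,1);(0,-1)].
Proof.
case: u v => [a b] [c d]; rewrite /unit_step /= => H; exists (c - a, d - b).
  by rewrite /= !subrKC.
by rewrite !inE !xpair_eqE; lia.
Qed.

(** The four secants form a closed lattice loop of four unit steps. Its crossing number is 0 unless
    it goes round the unit square with corners (0,0), (1,0), (0,-1), (1,-1), which contains the end
    of the ray. That square has the origin as a corner, and the inequalities exclude zero
    secants. *)
Lemma ray_square (p p' q q' : vertex) : unit_step p p' -> unit_step q q' ->
  p != q -> p != q' -> p' != q -> p' != q' ->
  ray (vec p q) (vec p q') + ray (vec p q') (vec p' q') =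
  ray (vec p q) (vec p' q) + ray (vec p' q) (vec p' q').
Proof.
case: p q => [p1 p2] [q1 q2] /unit_stepP[[s1 s2] -> Hs] /unit_stepP[[t1 t2] -> Ht].
move: Hs Ht; rewrite !inE !xpair_eqE /= /ray /vec /=.
by move=> /or4P[] /andP[/eqP-> /eqP->] /or4P[] /andP[/eqP-> /eqP->] ;
  do 4 (case: ifPn); lia.
Qed.

(* Together with ray, this counts half turns, which are the same for d and -d. *)
Definition lower (d : int * int) : bool := (d.2 < 0) || ((d.2 == 0) && (d.1 < 0)).

(** The left-hand side counts crossings of the opposite ray x < 0, y = 1/2. A counterclockwise
    passage over that ray enters the half plane [lower], one over the original ray leaves it, so the
    two counts differ by the change of [lower]. *)
Lemma ray_opp (p q q' : vertex) : unit_step q q' -> p != q -> p != q' ->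
  ray (vec q p) (vec q' p) =
  ray (vec p q) (vec p q') + (lower (vec p q'))%:Z - (lower (vec p q))%:Z.
Proof.
rewrite !vertexE /unit_step /ray /vec /lower.
case: p q q' => [p1 p2] [q1 q2] [q1' q2'] /=.
do 2 (case: ifPn); lia.
Qed.

Lemma adjE (u v : vertex) : adj u v =
  ((v.1 == u.1) && ((v.2 == u.2 + 1) || (u.2 == v.2 + 1))) ||
  ((v.2 == u.2) && (if even_vertex u then v.1 == u.1 + 1 else u.1 == v.1 + 1)).
Proof.
rewrite /adj /edge_between /is_edge /vertical /horizontal.
case: ifP; rewrite /= /above /right_of !vertexE /=; case: ifP => //;
  rewrite /even_vertex; lia.
Qed.

Lemma adj_step u v : adj u v -> unit_step u v.
Proof. by rewrite adjE /unit_step; case: ifP; lia. Qed.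

Lemma mem_cw_neighbours u v : (v \in cw_neighbours u) = adj u v.
Proof.
rewrite adjE /cw_neighbours; case: ifPn => H;
  rewrite !inE /above /below /left_of /right_of !vertexE /=; lia.
Qed.

(* In units of pi / 3, once H is drawn as the regular hexagonal lattice. *)
Definition angle (u v : vertex) : int :=
  if v == right_of u then 0 else if v == left_of u then 3 else
  if v == above u then (if even_vertex u then 2 else 1) else (if even_vertex u then
    4 else 5).

(** For three successive vertices, the secant passes from (i, i+1) over (i, i+2) to (i+1, i+2),
    along the diagonal of the triangle i < j. *)
Definition corner (u v t : vertex) : int :=
  ray (vec u v) (vec u t) + ray (vec u t) (vec v t).

(** Angles run from 0 to 5 and jump where the direction passes the ray; [corner] is the signed
    correction for that jump. The proof checks the parity of u and the two steps. *)
Lemma hook_angle (u v t : vertex) : adj u v -> adj v t -> u != t ->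
  hook_weight u v t = angle v t - angle u v + 6 * corner u v t.
Proof.
rewrite -!mem_cw_neighbours /hook_weight /corner /angle.
case: u => [a b]; rewrite /cw_neighbours /even_vertex /=.
case: ifPn => Ha; rewrite !inE;
move=> /or3P[] /eqP-> /=; decide_ifs; rewrite !inE => /or3P[] /eqP->;
  rewrite /above /below /left_of /right_of /= !xpair_eqE => ut;
first [exfalso; lia | decide_ifs; rewrite /ray /vec /=; decide_ifs; lia].
Qed.

(** * Sweeps and secants *)

(** Here p is the initial point of all secants, in [cosweep] it is their end: the two sides of the
    triangle i < j other than the diagonal. *)
Definition sweep (p : vertex) (v : nat -> vertex) (m n : nat) : int :=
  \sum_(m <= i < n) ray (vec p (v i)) (vec p (v i.+1)).

Definition cosweep (p : vertex) (v : nat -> vertex) (m n : nat) : int :=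
  \sum_(m <= i < n) ray (vec (v i) p) (vec (v i.+1) p).

Lemma sweep_recr p v m n : (m <= n)%N ->
  sweep p v m n.+1 = sweep p v m n + ray (vec p (v n)) (vec p (v n.+1)).
Proof. by move=> mn; rewrite /sweep big_nat_recr. Qed.

Lemma sweep_recl p v m n : (m < n)%N ->
  sweep p v m n = ray (vec p (v m)) (vec p (v m.+1)) + sweep p v m.+1 n.
Proof. by move=> mn; rewrite /sweep big_ltn. Qed.

Lemma cosweep_recr p v m n : (m <= n)%N ->
  cosweep p v m n.+1 = cosweep p v m n + ray (vec (v n) p) (vec (v n.+1) p).
Proof. by move=> mn; rewrite /cosweep big_nat_recr. Qed.

Lemma cosweep_recl p v m n : (m < n)%N ->
  cosweep p v m n = ray (vec (v m) p) (vec (v m.+1) p) + cosweep p v m.+1 n.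
Proof. by move=> mn; rewrite /cosweep big_ltn. Qed.

(** [ray_square] summed over a strip of squares: the terms across the strip telescope, and only
    those at its two ends survive. *)
Lemma sweep_shift p p' v m n : (m <= n)%N -> unit_step p p' ->
  (forall i, (m <= i < n)%N -> unit_step (v i) (v i.+1)) ->
  (forall i, (m <= i <= n)%N -> p != v i /\ p' != v i) ->
  sweep p v m n + ray (vec p (v n)) (vec p' (v n)) =
  ray (vec p (v m)) (vec p' (v m)) + sweep p' v m n.
Proof.
move=> mn pp' vS vN; suff : sweep p' v m n - sweep p v m n =
    ray (vec p (v n)) (vec p' (v n)) - ray (vec p (v m)) (vec p' (v m)) by lia.
rewrite -[RHS](telescope_sumr (fun i => ray (vec p (v i)) (vec p' (v i)))) //.
rewrite /sweep -sumrB; apply: eq_big_nat => i /andP[mi ni].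
have [|? ?] := vN i; first lia. have [|? ?] := vN i.+1; first lia.
have := @ray_square p p' (v i) (v i.+1) pp'.
move=> /(_ (vS _ _)) H; move: H; rewrite mi ni => /(_ isT).
lia.
Qed.

Lemma cosweep_shift p p' v m n : (m <= n)%N -> unit_step p p' ->
  (forall i, (m <= i < n)%N -> unit_step (v i) (v i.+1)) ->
  (forall i, (m <= i <= n)%N -> p != v i /\ p' != v i) ->
  cosweep p v m n + ray (vec (v n) p) (vec (v n) p') =
  ray (vec (v m) p) (vec (v m) p') + cosweep p' v m n.
Proof.
move=> mn pp' vS vN; suff : cosweep p' v m n - cosweep p v m n =
    ray (vec (v n) p) (vec (v n) p') - ray (vec (v m) p) (vec (v m) p') by lia.
rewrite -[RHS](telescope_sumr (fun i => ray (vec (v i) p) (vec (v i) p'))) //.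
rewrite /cosweep -sumrB; apply: eq_big_nat => i /andP[mi ni].
have [|? ?] := vN i; first lia. have [|? ?] := vN i.+1; first lia.
have := @ray_square (v i) (v i.+1) p p'.
move=> /(_ (vS _ _)) H; move: H; rewrite mi ni => /(_ isT pp').
rewrite ![v _ == _]eq_sym; lia.
Qed.

(** [ray_opp] summed over the walk, so that both sides of the triangle become crossings seen from a
    fixed point. *)
Lemma cosweepE p v m n : (m <= n)%N ->
  (forall i, (m <= i < n)%N -> unit_step (v i) (v i.+1)) ->
  (forall i, (m <= i <= n)%N -> p != v i) ->
  cosweep p v m n = sweep p v m n + (lower (vec p (v n)))%:Z - (lower (vec p (v m)))%:Z.
Proof.
move=> mn vS vN; rewrite -addrA -(telescope_sumr (fun i => (lower (vec p (v
  i)))%:Z)) //.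
rewrite /sweep -big_split; apply: eq_big_nat => i /andP[mi ni] /=.
rewrite addrA; apply: ray_opp; [apply: vS | apply: vN | apply: vN]; lia.
Qed.

(* The secant map (i, j) |-> v j - v i on the triangle i < j never vanishes, so the
   diagonal can be deformed into the other two sides. *)
Lemma corner_sum v n : (0 < n)%N ->
  (forall i, (i < n)%N -> unit_step (v i) (v i.+1)) ->
  (forall i j, (i < j <= n)%N -> v i != v j) ->
  \sum_(0 <= i < n.-1) corner (v i) (v i.+1) (v i.+2) =
  sweep (v 0%N) v 1 n + cosweep (v n) v 0 n.-1.
Proof.
case: n => // n _; elim: n => [|n IH] vS vN; first by rewrite /sweep /cosweep !big_geq.
rewrite /= big_nat_recr //= IH; last 2 first.
- by move=> i ?; apply: vS; lia.
- by move=> i j ?; apply: vN; lia.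
rewrite /corner [sweep _ _ _ n.+2]sweep_recr // [cosweep _ _ _ n.+1]cosweep_recr //.
(* The new vertex adds one column of squares, between the secants to [v n.+1] and those to
   [v n.+2]. *)
have := @cosweep_shift (v n.+1) (v n.+2) v 0 n (leq0n _) (vS _ _).
move=> /(_ (leqnn _)) H.
have {}H : cosweep (v n.+1) v 0 n + ray (vec (v n) (v n.+1)) (vec (v n) (v n.+2)) =
  ray (vec (v 0%N) (v n.+1)) (vec (v 0%N) (v n.+2)) + cosweep (v n.+2) v 0 n.
  apply: H => i ?; first by apply: vS; lia.
  by rewrite ![_ == v i]eq_sym; split; apply: vN; lia.
rewrite /=; lia.
Qed.

(* The same deformation, except that it goes around the corner (0, n), where the
   secant may vanish. *)
Lemma corner_sum_closed v n : (2 < n)%N ->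
  (forall i, (i < n)%N -> unit_step (v i) (v i.+1)) ->
  (forall i j, (i < j < n)%N -> v i != v j) ->
  (forall i, (0 < i < n)%N -> v i != v n) ->
  \sum_(0 <= i < n.-1) corner (v i) (v i.+1) (v i.+2) =
  sweep (v 0%N) v 1 n.-1 + ray (vec (v 0%N) (v n.-1)) (vec (v 1%N) (v n.-1)) +
  ray (vec (v 1%N) (v n.-1)) (vec (v 1%N) (v n)) + cosweep (v n) v 1 n.-1.
Proof.
case: n => // [[|[|n]]] // _ vS vN vN'; rewrite big_nat_recr //=.
rewrite (@corner_sum v n.+2) //; last by move=> i ?; apply: vS; lia.
rewrite [cosweep _ _ 0 _]cosweep_recl // [cosweep _ _ _ n.+2]cosweep_recr // /corner.
(* The last column starts at index 1, because [v 0] may coincide with the final vertex. *)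
have := @cosweep_shift (v n.+2) (v n.+3) v 1 n.+1 isT (vS _ _).
move=> /(_ (leqnn _)) H.
have {}H : cosweep (v n.+2) v 1 n.+1 + ray (vec (v n.+1) (v n.+2)) 
    (vec (v n.+1) (v n.+3)) =
  ray (vec (v 1%N) (v n.+2)) (vec (v 1%N) (v n.+3)) + cosweep (v n.+3) v 1 n.+1.
  apply: H => i ?; first by apply: vS; lia.
  by rewrite ![_ == v i]eq_sym; split; [apply: vN|apply: vN']; lia.
rewrite /=; lia.
Qed.

(** * Turning of walks *)

(** From a viewpoint to the left of the box all secants have positive first coordinate, so the
    crossings telescope; from any other far viewpoint nothing crosses the ray. Either way only the
    endpoints of the walk matter. *)
Lemma sweep_far (N : nat) (q : vertex) v m n : (m <= n)%N ->
  (N < absz q.1)%N || (N < absz q.2)%N ->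
  (forall i, (m <= i < n)%N -> unit_step (v i) (v i.+1)) ->
  (forall i, (m <= i <= n)%N -> (absz (v i).1 <= N)%N /\ (absz (v i).2 <= N)%N) ->
  sweep q v m n = if q.1 < - N%:Z then ((v m).2 < q.2)%R%:Z - ((v n).2 < q.2)%R%:Z
    else 0.
Proof.
move=> mn qN vS vN; case: ifPn => [qlt|qge].
  rewrite -opprB -(telescope_sumr (fun i => ((v i).2 < q.2)%R%:Z)) // /sweep -sumrN.
  apply: eq_big_nat => i ?; rewrite /ray /vec /=.
  have [|? ?] := vN i; first lia. have [|? ?] := vN i.+1; first lia.
  decide_ifs; lia.
rewrite /sweep big_nat big1 // => i ?; rewrite /ray /vec /=; case: ifP => // *.
have [|? ?] := vN i; first lia. have [|? ?] := vN i.+1; first lia.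
have := vS i; rewrite /unit_step; lia.
Qed.

Lemma infinite_far (A : set vertex) (N : nat) : infinite_set A ->
  exists2 q, A q & (N < absz q.1)%N || (N < absz q.2)%N.
Proof.
move=> Ainf; apply: contrapT => noq; apply: Ainf.
pose I : set int := [set z | (absz z <= N)%N].
have finI : finite_set I.
  apply: (@sub_finite_set _ _ ((fun k : 'I_(N + N).+1 => k%:Z - N%:Z) @` setT)).
    rewrite /I => z /= zN; have lt : (absz ((z : int) + N%:Z)%R < (N + N).+1)%N by lia.
    by exists (Ordinal lt) => //=; lia.
  by apply: finite_image; apply: finite_finset.
apply: (@sub_finite_set _ _ (I `*` I)); last exact: finite_setX.
move=> q Aq; rewrite /I /=; apply: contrapT => h; apply: noq; exists q => //.
by apply/negPn/negP => h'; apply: h; split=> /=; lia.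
Qed.

Lemma coord_bound (v : nat -> vertex) n :
  exists N : nat, forall i, (i <= n)%N ->
    (absz (v i).1 <= N)%N /\ (absz (v i).2 <= N)%N.
Proof.
elim: n => [|n [N IH]].
  by exists (absz (v 0%N).1 + absz (v 0%N).2)%N => i; rewrite leqn0 => /eqP->; lia.
exists (N + absz (v n.+1).1 + absz (v n.+1).2)%N => i;
  rewrite leq_eqVlt => /orP[/eqP->|].
  by lia.
by move=> /IH; lia.
Qed.

(** * Invariance of the index of a loop *)

Section IndexInvariance.
Variables (X : set vertex) (v v' : nat -> vertex) (m n m' n' : nat).
Hypothesis mn : (m <= n)%N.
Hypothesis mn' : (m' <= n')%N.
Hypothesis vS : forall i, (m <= i < n)%N -> unit_step (v i) (v i.+1).
Hypothesis vS' : forall i, (m' <= i < n')%N -> unit_step (v' i) (v' i.+1).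
Hypothesis vX : forall i, (m <= i <= n)%N -> X (v i).
Hypothesis vX' : forall i, (m' <= i <= n')%N -> X (v' i).
Hypothesis vm : v m = v' m'.
Hypothesis vn : v n = v' n'.

(** The difference is the index of the loop formed by v and the reverse of v'. The correction terms
    of [sweep_shift] depend only on the common endpoints, so they cancel at each step of the
    viewpoint. *)
Lemma sweep_diff_reachable p q : reachable (~` X) p q ->
  sweep p v m n - sweep p v' m' n' = sweep q v m n - sweep q v' m' n'.
Proof.
move=> [s []]; elim: s p => [p _ /= -> //|t s IH p /=].
move=> /andP[pt ts] sq sX; rewrite -(IH t) //; last by move=> u us; apply: sX;
  rewrite inE us orbT.
have offX z : X z -> p != z /\ t != z.
  move=> Xz; split; apply/eqP => e; subst z; last first.
    by apply: (sX t) => //; rewrite !inE eqxx orbT.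
  by apply: (sX p) => //; rewrite !inE eqxx.
have := @sweep_shift p t v m n mn (adj_step pt) vS (fun i hi => offX _ (vX hi)).
have := @sweep_shift p t v' m' n' mn' (adj_step pt) vS' (fun i hi => offX _ (vX' hi)).
rewrite vm vn; lia.
Qed.

(** The viewpoint moves off X out of a box that contains both walks, where [sweep_far] sees only the
    common endpoints. *)
Lemma sweep_unique p : infinite_set (component_in_H (~` X) p) ->
  sweep p v m n = sweep p v' m' n'.
Proof.
move=> pinf; have [N1 vN1] := coord_bound v n; have [N2 vN2] := coord_bound v' n'.
have [q pq qN] := infinite_far (N1 + N2) pinf.
apply/eqP; rewrite -subr_eq0 (sweep_diff_reachable pq).
rewrite (sweep_far mn qN vS); last by move=> i ?; have := vN1 i; lia.
rewrite (sweep_far mn' qN vS'); last by move=> i ?; have := vN2 i; lia.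
by rewrite vm vn subrr.
Qed.

End IndexInvariance.

(** * Total turning in terms of sweeps *)

Definition turning (v : nat -> vertex) (n : nat) : int :=
  \sum_(0 <= i < n.-1) hook_weight (v i) (v i.+1) (v i.+2).

Lemma turning_corner v n : (0 < n)%N ->
  (forall i, (i < n)%N -> adj (v i) (v i.+1)) ->
  (forall i, (i.+1 < n)%N -> v i != v i.+2) ->
  turning v n = angle (v n.-1) (v n) - angle (v 0%N) (v 1%N) +
    6 * \sum_(0 <= i < n.-1) corner (v i) (v i.+1) (v i.+2).
Proof.
case: n => // n _ vA vN /=.
rewrite -(telescope_sumr (fun i => angle (v i) (v i.+1))) //.
rewrite mulr_sumr -big_split; apply: eq_big_nat => i /andP[_ ni] /=.
by apply: hook_angle; [apply: vA|apply: vA|apply: vN]; lia.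
Qed.

(** The vertices [v 0] and [v n] may or may not coincide. All terms except the two sweeps depend
    only on the first and the last edge, and both sweeps run over inner vertices. *)
Lemma turning_closed v n : (2 < n)%N ->
  (forall i, (i < n)%N -> adj (v i) (v i.+1)) ->
  (forall i j, (i < j < n)%N -> v i != v j) ->
  (forall i, (0 < i < n)%N -> v i != v n) ->
  turning v n = angle (v n.-1) (v n) - angle (v 0%N) (v 1%N) +
    6 * (sweep (v 0%N) v 1 n.-1 + ray (vec (v 0%N) (v n.-1)) (vec (v 1%N) (v n.-1)) +
         ray (vec (v 1%N) (v n.-1)) (vec (v 1%N) (v n)) +
         (sweep (v n) v 1 n.-1 +
          (lower (vec (v n) (v n.-1)))%:Z - (lower (vec (v n) (v 1%N)))%:Z)).
Proof.
move=> n2 vA vN vN'; have vS i : (i < n)%N -> unit_step (v i) (v i.+1).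
  by move=> ?; apply/adj_step/vA.
rewrite turning_corner //; last 2 first.
- lia.
- move=> i ii; have [e|ne] := eqVneq i.+2 n; last by apply: vN; lia.
  by rewrite e; apply: vN'; lia.
rewrite corner_sum_closed // cosweepE //; first lia.
- by move=> i ?; apply: vS; lia.
- by move=> i ?; rewrite eq_sym; apply: vN'; lia.
Qed.

(** By [turning_closed] the turnings can differ only in the sweeps about [v 0] and [v n]. The inner
    vertices lie in X and both viewpoints in infinite components of its complement, so
    [sweep_unique] applies. *)
Lemma turning_unique X v v' n n' : (2 < n)%N -> (2 < n')%N ->
  (forall i, (i < n)%N -> adj (v i) (v i.+1)) ->
  (forall i, (i < n')%N -> adj (v' i) (v' i.+1)) ->
  (forall i j, (i < j < n)%N -> v i != v j) ->
  (forall i j, (i < j < n')%N -> v' i != v' j) ->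
  (forall i, (0 < i < n)%N -> X (v i)) ->
  (forall i, (0 < i < n')%N -> X (v' i)) ->
  infinite_set (component_in_H (~` X) (v 0%N)) ->
  infinite_set (component_in_H (~` X) (v n)) ->
  ~ X (v n) ->
  v 0%N = v' 0%N -> v 1%N = v' 1%N -> v n.-1 = v' n'.-1 -> v n = v' n' ->
  turning v n = turning v' n'.
Proof.
move=> n2 n2' vA vA' vN vN' vX vX' inf0 infn nX e0 e1 en1 en.
have XN z : X z -> z != v n by move=> Xz; apply/eqP => e; rewrite e in Xz.
rewrite !turning_closed //; last 2 first.
- by move=> i ?; rewrite -en; apply/XN/vX'.
- by move=> i ?; apply/XN/vX.
have sw p : infinite_set (component_in_H (~` X) p) ->
  sweep p v 1 n.-1 = sweep p v' 1 n'.-1.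
  apply: sweep_unique => // [||i ?|i ?|i ?|i ?]; try lia.
  - by apply/adj_step/vA; lia.
  - by apply/adj_step/vA'; lia.
  - by apply: vX; lia.
  - by apply: vX'; lia.
by rewrite -e0 -e1 -en1 -en !sw.
Qed.

Lemma adjC u v : adj u v = adj v u.
Proof. by rewrite !adjE /even_vertex; do 2 case: ifP; lia. Qed.

(** The cycle has index 0 about its neighbour p; [sweep_shift] carries this view to [v 0], about
    which both sweeps of [turning_closed] are taken. If the first turn is to the left, the cycle
    runs clockwise and turns by -6 in total; adding the left hook at entry and removing the right
    hook at [v 0] leaves -4. *)
Lemma turning_cycle p v n : (2 < n)%N ->
  (forall i, (i < n)%N -> adj (v i) (v i.+1)) ->
  (forall i j, (i < j < n)%N -> v i != v j) ->
  (forall i, (i < n)%N -> p != v i) ->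
  v n = v 0%N -> adj p (v 0%N) ->
  sweep p v 0 n = 0 ->
  turning v n + hook_weight p (v 0%N) (v 1%N) =
  if v 1%N == next (cw_neighbours (v 0%N)) p then - 4 else 4.
Proof.
move=> n2 vA vN pv vn pv0 sw0.
have vS i : (i < n)%N -> unit_step (v i) (v i.+1).
  by move=> ?; apply/adj_step/vA.
have vN' i : (0 < i < n)%N -> v i != v n.
  by move=> ?; rewrite vn eq_sym; apply: vN; lia.
rewrite turning_closed //.
have [k ek] : exists k, n = k.+3 by exists (n - 3)%N; lia.
subst n; rewrite /=.
move: sw0; rewrite sweep_recl // sweep_recr //.
have := @sweep_shift p (v 0%N) v 1 k.+2 isT (adj_step pv0).
move=> H; have {}H : sweep p v 1 k.+2 + ray (vec p (v k.+2)) (vec (v 0%N) (v k.+2)) =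
   ray (vec p (v 1%N)) (vec (v 0%N) (v 1%N)) + sweep (v 0%N) v 1 k.+2.
  apply: H => i ?; first by apply: vS; lia.
  by split; [apply: pv | apply: vN]; lia.
move: H; rewrite vn.
have := vA 0%N isT; have := vA k.+2 (leqnn _); rewrite vn.
have : p != v 1%N by apply: pv.
have : p != v k.+2 by apply: pv.
have : v 1%N != v k.+2 by apply: vN; lia.
(* What is left is local to [v 0] and its three neighbours, the two sweeps being integers bound by
   linear relations; this is a finite check. *)
move: (sweep p v 1 k.+2) (sweep (v 0%N) v 1 k.+2) => s t.
move: pv0; clear.
move: (v 0%N) (v 1%N) (v k.+2) => a b c.
rewrite ![adj _ a]adjC -!mem_cw_neighbours /hook_weight /angle.
case: a => [x y]; rewrite /cw_neighbours /even_vertex /=.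
case: ifPn => Ha; rewrite !inE;
move=> /or3P[] /eqP-> bc pc pb /or3P[] /eqP ec /or3P[] /eqP eb; move: bc pc pb;
rewrite ec eb /above /below /left_of /right_of /= !xpair_eqE => bc pc pb;
first [exfalso; lia | rewrite /ray /vec /lower /=; decide_ifs;
  rewrite -?[lower _]/(_ || _) /=; lia].
Qed.

(** * Walks as sequences of vertices *)

Lemma edge_between_pair u v : edge_between u v = (u, v) \/ edge_between u v = (v, u).
Proof. by rewrite /edge_between; case: ifP; [left|right]. Qed.

Lemma edge_between_inj u v u' v' : edge_between u v = edge_between u' v' ->
  (u = u' /\ v = v') \/ (u = v' /\ v = u').
Proof.
by case: (edge_between_pair u v) => ->;
  case: (edge_between_pair u' v') => -> [-> ->]; auto.
Qed.

Lemma endvertex_edge_between t u v :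
  endvertex t (edge_between u v) = (t == u) || (t == v).
Proof. by case: (edge_between_pair u v) => ->; rewrite /endvertex //= orbC. Qed.

Lemma adj_neq u v : adj u v -> u != v.
Proof. by rewrite adjE vertexE; case: ifP; lia. Qed.

Lemma edge_betweenC u v : adj u v -> edge_between u v = edge_between v u.
Proof.
rewrite /adj /edge_between; case: ifP => [uv _|uv vu]; last by rewrite vu.
case: ifP => // vu; exfalso; move: uv vu.
rewrite /is_edge /vertical /horizontal /above /right_of !vertexE /=; lia.
Qed.

Lemma size_walk_edges w : size (walk_edges w) = (size w).-1.
Proof. by rewrite size_pairmap size_behead. Qed.

Lemma nth_walk_edges e0 w i : (i.+1 < size w)%N ->
  nth e0 (walk_edges w) i = edge_between (nth_vertex w i) (nth_vertex w i.+1).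
Proof.
case: w => // v w; rewrite /walk_edges /= ltnS => iw.
by rewrite (nth_pairmap (0, 0)).
Qed.

Lemma walk_lengthE w : walk_length w = (size w).-1.
Proof. exact: size_walk_edges. Qed.

Lemma walkP w : reflect
  [/\ (1 < size w)%N,
      forall i, (i.+1 < size w)%N -> adj (nth_vertex w i) (nth_vertex w i.+1)
    & forall i, (i.+2 < size w)%N -> nth_vertex w i != nth_vertex w i.+2]
  (walk w).
Proof.
rewrite /walk walk_lengthE.
have -> : (1 <= (size w).-1)%N = (1 < size w)%N by lia.
apply: (iffP and3P) => [[w1 /sortedP wA /sortedP wE]|[w1 wA wN]].
  split=> // [i|i iw]; first exact: wA.
  have iw' : (i.+1 < size (walk_edges w))%N by rewrite size_walk_edges; lia.
  apply/eqP => e; have := wE (((0,0),(0,0)) : edge) i iw'.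
  rewrite !nth_walk_edges ?(ltnW iw) // -e edge_betweenC ?eqxx //.
  by apply: wA; lia.
split=> //; first by apply/(sortedP ((0,0) : vertex)) => i; apply: wA.
apply/(sortedP (((0,0),(0,0)) : edge)) => i; rewrite size_walk_edges => iw.
rewrite !nth_walk_edges; try lia.
apply/eqP => /edge_between_inj[[e _]|[e _]].
  by have := adj_neq (wA i (ltac:(lia))); rewrite -e eqxx.
by have := wN i (ltac:(lia)); rewrite e eqxx.
Qed.

Lemma windingE w : winding w = turning (nth_vertex w) (walk_length w).
Proof. by rewrite /winding /turning big_mkord. Qed.

(** For a walk arriving at v from u, [true] is the left turn and [false] the right turn. *)
Definition third (u v : vertex) (b : bool) : vertex :=
  if b then next (cw_neighbours v) u else prev (cw_neighbours v) u.

Lemma thirdP u v b : adj u v ->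
  [/\ adj v (third u v b), third u v b != u &
      hook_weight u v (third u v b) = if b then 1 else -1].
Proof.
rewrite adjC -!mem_cw_neighbours /hook_weight /third.
case: v => [x y]; rewrite /cw_neighbours /even_vertex /=.
case: ifPn => H; rewrite !inE => /or3P[] /eqP->;
  case: b; rewrite /above /below /left_of /right_of /=; decide_ifs;
  split; rewrite ?inE; decide_ifs; lia.
Qed.

Lemma third_onto u v t : adj u v -> adj v t -> t != u ->
  t = third u v (hook_weight u v t == 1).
Proof.
rewrite adjC -!mem_cw_neighbours /hook_weight /third.
case: v => [x y]; rewrite /cw_neighbours /even_vertex /=.
case: ifPn => H; rewrite !inE => /or3P[] /eqP-> /or3P[] /eqP->;
  rewrite /above /below /left_of /right_of /= !xpair_eqE => ne; first [exfalso;
    lia|decide_ifs];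
  congr pair; lia.
Qed.

(** * Walks in a domain *)

Lemma uniq_nth_vertex w : reflect
  (forall i j, (i < j < size w)%N -> nth_vertex w i != nth_vertex w j) (uniq w).
Proof.
apply: (iffP (uniqP ((0, 0) : vertex))) => [wU i j /andP[ij jw]|wU i j].
  have iw := ltn_trans ij jw.
  by apply/eqP => /(wU _ _ iw jw) e; rewrite e ltnn in ij.
rewrite !inE => iw jw e; have [ij|ji|//] := ltngtP i j.
  by have := wU i j; rewrite /nth_vertex e eqxx ij jw => /(_ isT).
by have := wU j i; rewrite /nth_vertex e eqxx ji iw => /(_ isT).
Qed.

Definition outer_endvertex (X : set vertex) (e : edge) : vertex :=
  if `[< X e.1 >] then e.2 else e.1.

Lemma first_edge_border X a w : border X a -> first_edge w = a ->
  ~ X (first_vertex w) ->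
  nth_vertex w 0 = outer_endvertex X a /\ nth_vertex w 1 = inner_endvertex X a.
Proof.
move=> [_ ha] wa; rewrite /outer_endvertex /inner_endvertex.
move: wa ha; rewrite /first_edge /first_vertex.
case: (edge_between_pair (nth_vertex w 0) (nth_vertex w 1)) => -> <- /=;
  case: asboolP => //=; tauto.
Qed.

(* The walks of length n of all the sets X(a, e), together with those that end in X. *)
Definition domain_paths (X : set vertex) (a : edge) (n : nat) : set (seq vertex) :=
  [set w | [/\ weak_SAW w, first_edge w = a, ~ X (first_vertex w), size w = n.+1
             & forall i, (0 < i < n)%N -> X (nth_vertex w i)]].

Definition domain_SAWs_of_length (X : set vertex) (a : edge) (n : nat) : set (seq
  vertex) :=
  domain_SAWs X a `&` [set w | walk_length w = n].

Lemma domain_SAWs_ofE X a n w : (0 < n)%N -> domain_SAWs_of_length X a n w <->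
  [/\ domain_paths X a n w, uniq w & X (nth_vertex w n)].
Proof.
move=> n0; split=> [[[/andP[wW wU] wa wX wbX] /=]|].
  rewrite walk_lengthE => sw; have [s1 _ _] := walkP _ wW.
  have bX i : (0 < i < size w)%N -> X (nth_vertex w i).
    case: i => // i; rewrite /nth_vertex /= => iw.
    by rewrite -nth_behead; apply: wbX; apply: mem_nth;
      rewrite size_behead -subn1 ltn_subRL.
  split=> //; last by apply: bX; lia.
  split=> //; [|lia|by move=> i ?; apply: bX; lia].
  by rewrite /weak_SAW wW take_uniq.
move=> [[/andP[wW _] wa wX sw wbX] wU wnX]; split; last by rewrite /= walk_lengthE sw.
split=> //; first by rewrite /SAW wW.
move=> v vw; rewrite -(nth_index ((0, 0) : vertex) vw) nth_behead.
have := vw; rewrite -index_mem size_behead sw; move: (index _ _) => i /= ni.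
have [->//|ne] := eqVneq i.+1 n; apply: wbX; lia.
Qed.

Lemma walk_rcons w t : (1 < size w)%N ->
  walk (rcons w t) = [&& walk w, adj (nth_vertex w (size w).-1) t
                      & nth_vertex w (size w).-2 != t].
Proof.
move=> w1; apply/walkP/and3P; rewrite size_rcons.
  have nthE i : (i < size w)%N -> nth_vertex (rcons w t) i = nth_vertex w i.
    by move=> iw; rewrite /nth_vertex nth_rcons iw.
  have nthL : nth_vertex (rcons w t) (size w) = t.
    by rewrite /nth_vertex nth_rcons ltnn eqxx.
  move=> [_ wA wN]; split.
  - apply/walkP; split=> // i iw.
      by have := wA i; rewrite !nthE; last lia; [apply; lia|lia].
    by have := wN i; rewrite !nthE; last lia; [apply; lia|lia].
  - have := wA (size w).-1; rewrite nthE ?prednK ?nthL; try lia; by apply; lia.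
  - have := wN (size w).-2; rewrite nthE; last lia.
    have -> : (size w).-2.+2 = size w by lia.
    by rewrite nthL; apply; lia.
move=> [/walkP[_ wA wN] wt wnt]; split; first lia.
  move=> i iw; rewrite /nth_vertex !nth_rcons; case: ifP => ?; last lia.
  case: ifP => ?; first exact: wA.
  case: ifP => ?; last lia.
  by have -> : i = (size w).-1 by lia.
move=> i iw; rewrite /nth_vertex !nth_rcons; case: ifP => ?; last lia.
case: ifP => ?; first exact: wN.
case: ifP => ?; last lia.
by have -> : i = (size w).-2 by lia.
Qed.

(** Weak self-avoidance leaves the final vertex free apart from the ban on backtracks, so the walks
    of length at least 2 are exactly the one-step extensions of walks in S. *)
Lemma domain_paths_rcons X a n w t : (0 < n)%N -> size w = n.+1 ->
  domain_paths X a n.+1 (rcons w t) <->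
  [/\ domain_SAWs_of_length X a n w, adj (nth_vertex w n) t & nth_vertex w n.-1 != t].
Proof.
move=> n0 sw; have SE := domain_SAWs_ofE X a w n0.
suff : domain_paths X a n.+1 (rcons w t) <->
    [/\ [/\ domain_paths X a n w, uniq w & X (nth_vertex w n)],
        adj (nth_vertex w n) t & nth_vertex w n.-1 != t].
  by move=> E; split=> [/E[/SE]|[/SE]] // *; apply/E.
have nthE i : (i < size w)%N -> nth_vertex (rcons w t) i = nth_vertex w i.
  by move=> iw; rewrite /nth_vertex nth_rcons iw.
have takeE : take (size w) (rcons w t) = w by rewrite -cats1 take_size_cat.
rewrite /domain_paths /= /weak_SAW walk_lengthE size_rcons /= takeE.
rewrite walk_rcons sw ?ltnS //=.
rewrite /first_edge /first_vertex !nthE ?sw ?ltnS // walk_lengthE sw /=.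
split.
  move=> [/andP[/and3P[wW wt wnt] wU] wa wX _ wbX].
  split=> //; split=> //; last by rewrite -nthE; [apply: wbX|]; lia.
  split=> //; first by rewrite wW take_uniq.
  by move=> i ?; rewrite -nthE; [apply: wbX|]; lia.
move=> [[[/andP[wW _] wa wX _ wbX] wU wnX] wt wnt]; split=> //.
  by rewrite wW wt wnt.
move=> i ?; rewrite nthE; last lia.
have [->//|?] := eqVneq i n; apply: wbX; lia.
Qed.

(** Reindexes the walks of length n + 1 by a walk of S and a turn; the two turns yield the two terms
    of the factor that contain x. *)
Lemma set_bij_extend X a n : (0 < n)%N ->
  set_bij (domain_SAWs_of_length X a n `*` [set: bool]) (domain_paths X a n.+1)
    (fun p => rcons p.1 (third (nth_vertex p.1 n.-1) (nth_vertex p.1 n) p.2)).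
Proof.
move=> n0.
have adjP w : domain_SAWs_of_length X a n w ->
    size w = n.+1 /\ adj (nth_vertex w n.-1) (nth_vertex w n).
  move=> [[/andP[wW _] _ _ _] /=]; rewrite walk_lengthE => sw.
  have [s1 wA _] := walkP _ wW; split; first lia.
  by have := wA n.-1; rewrite prednK //; apply; lia.
split.
- move=> [w b] /= [wS _]; have [sw wA] := adjP _ wS.
  apply/domain_paths_rcons => //; have [? ne _] := thirdP b wA.
  by split=> //; rewrite eq_sym.
- move=> [w b] [w' b'] /set_mem/= [wS _] /set_mem/= [wS' _] /rcons_inj[<- e].
  have [_ wA] := adjP _ wS; congr pair.
  have [_ _] := thirdP b wA; have [_ _] := thirdP b' wA; rewrite e => ->.
  by case: b b' {e} => [] [].
- move=> w wP; have [_ _ _ sw _] := wP; move: wP sw.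
  case/lastP: w => // w t; rewrite size_rcons => wP [sw].
  have [wS wt wnt] := (domain_paths_rcons X a t n0 sw).1 wP.
  have [_ wA] := adjP _ wS.
  exists (w, hook_weight (nth_vertex w n.-1) (nth_vertex w n) t == 1) => //=.
  by rewrite -third_onto // eq_sym.
Qed.

Lemma finite_domain_paths X a n : border X a -> finite_set (domain_paths X a n).
Proof.
(* A larger set, keeping only the start and adjacency; it is finite by induction, every vertex
   having three neighbours. *)
move=> ha; pose L n := [set w : seq vertex |
  [/\ size w = n.+1, nth_vertex w 0 = outer_endvertex X a &
      forall i, (i.+1 < size w)%N -> adj (nth_vertex w i) (nth_vertex w i.+1)]].
apply: (@sub_finite_set _ _ (L n)).
  move=> w [/andP[/walkP[_ wA _] _] wa wX sw _]; split=> //.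
  by have [] := first_edge_border ha wa wX.
elim: n => [|n IH].
  apply: (@sub_finite_set _ _ [set [:: outer_endvertex X a]]); last exact: finite_set1.
  by move=> w []; case: w => [|v []] //= _ <-.
apply: (@sub_finite_set _ _ ((fun p : seq vertex * 'I_3 =>
   rcons p.1 (nth ((0, 0) : vertex) (cw_neighbours (nth_vertex p.1 n)) p.2)) @` (L
     n `*` setT))).
  move=> w [sw w0 wA]; move: sw w0 wA; case/lastP: w => // w t.
  rewrite size_rcons => -[sw].
  have nthE i : (i < size w)%N -> nth_vertex (rcons w t) i = nth_vertex w i.
    by move=> iw; rewrite /nth_vertex nth_rcons iw.
  rewrite nthE ?sw // => w0 wA.
  have := wA n; rewrite nthE ?sw // {2}/nth_vertex nth_rcons sw ltnn eqxx => /(_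
    (ltnSn _)).
  rewrite -mem_cw_neighbours => /(nthP ((0, 0) : vertex))[k kl <-].
  have k3 : (k < 3)%N by move: kl; rewrite /cw_neighbours; case: ifP.
  exists (w, Ordinal k3) => //=; split=> //; split=> // i iw.
  by have := wA i; rewrite !nthE; try lia; apply; lia.
by apply: finite_image; apply: finite_setX => //; apply: finite_finset.
Qed.

(** * Closed self-avoiding walks *)

Local Notation nv := nth_vertex.

Definition closed_SAW (c : seq vertex) : Prop :=
  [/\ (3 < size c)%N, forall i, (i.+1 < size c)%N -> adj (nv c i) (nv c i.+1),
      forall i j, (i < j < (size c).-1)%N -> nv c i != nv c j
    & nv c (size c).-1 = nv c 0%N].

Definition subgraph_of_walk (c : seq vertex) : subgraph :=
  ([fset v in c]%fset, [fset e in walk_edges c]%fset).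

Lemma walk_edgesP c e : reflect
  (exists2 i, (i.+1 < size c)%N & e = edge_between (nv c i) (nv c i.+1))
  (e \in walk_edges c).
Proof.
apply: (iffP idP) => [ec|[i ic ->]].
  rewrite -(nth_index (((0, 0), (0, 0)) : edge) ec).
  have := ec; rewrite -index_mem size_walk_edges => ic.
  have ic' : ((index e (walk_edges c)).+1 < size c)%N by lia.
  by exists (index e (walk_edges c)) => //; rewrite nth_walk_edges.
rewrite -(nth_walk_edges (((0, 0), (0, 0)) : edge)) //; apply: mem_nth.
by rewrite size_walk_edges; lia.
Qed.

Lemma mem_nth_vertex c v : reflect (exists2 i, (i < size c)%N & v = nv c i) (v \in c).
Proof.
apply: (iffP idP) => [vc|[i ic ->]]; last exact: mem_nth.
by exists (index v c); rewrite ?index_mem // /nth_vertex nth_index.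
Qed.

(** Positions on a closed walk with n edges are taken modulo n, because entry n repeats entry 0. *)
Definition cpred (n i : nat) : nat := if i is j.+1 then j else n.-1.

Lemma cpred2_neq n i : (2 < n)%N -> cpred n (cpred n i) != i.
Proof. by case: n => [|[|[|n]]] //; case: i => [|[|i]] //=; lia. Qed.

Lemma cpred_neq n i : (2 < n)%N -> cpred n i != i.
Proof. by case: n => [|[|[|n]]] //; case: i => [|[|i]] //=; lia. Qed.

Section ClosedSAW.
Variable c : seq vertex.
Hypothesis hc : closed_SAW c.
Local Notation n := (size c).-1.

Lemma closed_SAW_inj i j : (i < n)%N -> (j < n)%N -> nv c i = nv c j -> i = j.
Proof.
have [_ _ cN _] := hc => iw jw e; have [ij|ji|//] := ltngtP i j.
  by have := cN i j; rewrite e eqxx ij jw => /(_ isT).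
by have := cN j i; rewrite e eqxx ji iw => /(_ isT).
Qed.

Lemma closed_SAW_cpred i : (i < n)%N -> nv c (cpred n i).+1 = nv c i.
Proof.
have [c3 _ _ ce] := hc; case: i => [|i] _; last by [].
by rewrite -ce /cpred; congr (nv c _); lia.
Qed.

Lemma cpred_lt i : (i < n)%N -> (cpred n i < n)%N.
Proof. by have [c3 _ _ _] := hc; case: i => [|i] /=; lia. Qed.

Lemma closed_SAW_succ i : (i < n)%N ->
  exists2 j, (j < n)%N & nv c j = nv c i.+1 /\ i = cpred n j.
Proof.
have [c3 _ _ ce] := hc => iN; have [e|ne] := eqVneq i.+1 n.
  by exists 0%N; [lia|rewrite e ce; split=> //=; lia].
by exists i.+1; [lia|].
Qed.

(** No backtrack occurs even at the base point: otherwise two cyclic predecessors would lead back to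
    the same position, against [cpred2_neq]. *)
Lemma closed_SAW_turn i : (i < n)%N -> nv c i.+1 != nv c (cpred n i).
Proof.
have [c3 _ _ ce] := hc => iN; have [j jN [<- ij]] := closed_SAW_succ iN.
apply/eqP => /(closed_SAW_inj jN (cpred_lt iN)) e.
have := @cpred2_neq n i; rewrite -e -ij eqxx => /(_ _)/negP[] //; lia.
Qed.

Lemma closed_SAW_mem v : v \in c -> exists2 i, (i < n)%N & v = nv c i.
Proof.
have [c3 _ _ ce] := hc => /mem_nth_vertex[i ic ->].
have [->|ne] := eqVneq i n; last by exists i => //; lia.
by exists 0%N => //; lia.
Qed.

(** Distinctness of the vertices settles two passages in the same direction; an edge passed in both
    directions would be a backtrack, against [closed_SAW_turn]. *)
Lemma closed_SAW_edge_inj i j : (i < n)%N -> (j < n)%N ->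
  edge_between (nv c i) (nv c i.+1) = edge_between (nv c j) (nv c j.+1) -> i = j.
Proof.
move=> iN jN /edge_between_inj[[/closed_SAW_inj-> //]|[e1 e2]].
have [k kN [ek jk]] := closed_SAW_succ jN.
have ik : i = k by apply: closed_SAW_inj => //; rewrite ek.
have := closed_SAW_turn iN; rewrite e2 ik jk eqxx; by [].
Qed.

Lemma uniq_walk_edges : uniq (walk_edges c).
Proof.
apply/(uniqP (((0, 0), (0, 0)) : edge)) => i j.
rewrite !inE size_walk_edges => iN jN.
rewrite !nth_walk_edges; try lia.
exact: closed_SAW_edge_inj.
Qed.

Lemma card_subgraph_of_walk : #|` (subgraph_of_walk c).2| = n.
Proof. by rewrite /= card_fseq undup_id ?uniq_walk_edges // size_walk_edges. Qed.

Lemma subgraph_two_regular : two_regular (subgraph_of_walk c).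
Proof.
move=> v; rewrite /= inE => /closed_SAW_mem[i iN ->].
set p := cpred n i; have pN : (p < n)%N := cpred_lt iN.
suff -> : [fset e in [fset e in walk_edges c] | endvertex (nv c i) e]%fset =
    [fset edge_between (nv c i) (nv c i.+1); edge_between (nv c p) (nv c p.+1)]%fset.
  rewrite cardfs2; case: eqP => // /(closed_SAW_edge_inj iN pN) e.
  have [c3 _ _ _] := hc; have := @cpred_neq n i;
    rewrite -/p -e eqxx => /(_ _)/negP[] //; lia.
apply/fsetP => e; rewrite !inE; apply/andP/orP.
  move=> [/walk_edgesP[j jc ->]]; rewrite endvertex_edge_between => /orP[] /eqP ij.
    by left; rewrite (closed_SAW_inj iN _ ij) //; lia.
  right; have jN : (j < n)%N by lia.
  have [k kN [ek jk]] := closed_SAW_succ jN.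
  have ik : i = k by apply: closed_SAW_inj => //; rewrite ek.
  by rewrite /p ik -jk.
by case=> /eqP ->; split; [apply/walk_edgesP; exists i => //;
  lia|rewrite endvertex_edge_between eqxx
  |apply/walk_edgesP; exists p => //;
    lia|rewrite endvertex_edge_between /p closed_SAW_cpred // eqxx orbT].
Qed.

Lemma subgraph_is_subgraph : is_subgraph (subgraph_of_walk c).
Proof.
have [_ cA _ _] := hc; move=> e; rewrite /= !inE => /walk_edgesP[i ic ->].
have h1 : nv c i \in c by apply/mem_nth_vertex; exists i => //; lia.
have h2 : nv c i.+1 \in c by apply/mem_nth_vertex; exists i.+1.
split; first by apply: cA.
  by case: (edge_between_pair (nv c i) (nv c i.+1)) => ->.
by case: (edge_between_pair (nv c i) (nv c i.+1)) => ->.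
Qed.

Lemma subgraph_connected : connected_subgraph (subgraph_of_walk c).
Proof.
have [c3 _ _ ce] := hc; split.
  apply/eqP => /fsetP/(_ (nv c 0%N)); rewrite !inE.
  suff -> : nv c 0%N \in c by [].
  by apply/mem_nth_vertex; exists 0%N => //; lia.
pose r s t := edge_between s t \in (subgraph_of_walk c).2.
have seg i k : (i + k < size c)%N ->
    exists p, path r (nv c i) p /\ last (nv c i) p = nv c (i + k).
  elim: k => [|k IH] ik; first by exists [::]; rewrite addn0.
  have [|p [pp pl]] := IH; first lia.
  exists (rcons p (nv c (i + k).+1)); rewrite last_rcons addnS; split=> //.
  rewrite rcons_path pp pl /r /= inE; apply/walk_edgesP; exists (i + k)%N => //; lia.
move=> u v; rewrite /= !inE => /closed_SAW_mem[i iN ->] /closed_SAW_mem[j jN ->].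
(* From u forward to the end of c, which is also its start, and from there on to v. *)
have [|p [pp pl]] := seg i (n - i)%N; first lia.
have [|q [qp ql]] := seg 0%N j; first lia.
exists (p ++ q); rewrite cat_path last_cat pp pl subnKC ?ce ?qp ?ql //.
exact: ltnW.
Qed.

Lemma subgraph_cycle_in X : (forall v, v \in c -> X v) ->
  cycle_in X (subgraph_of_walk c).
Proof.
move=> cX; split; [exact: subgraph_is_subgraph|exact: subgraph_two_regular
  |exact: subgraph_connected|].
by move=> v; rewrite /= inE; apply: cX.
Qed.

End ClosedSAW.

(** * Traversing a cycle *)

Lemma edge_endvertex e v : is_edge e -> endvertex v e ->
  exists2 s, e = edge_between v s & adj v s.
Proof.
move=> he; have ha : adj e.1 e.2 by rewrite /adj /edge_between -surjective_pairing he.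
have eE : e = edge_between e.1 e.2 by rewrite /edge_between -surjective_pairing he.
case/orP => /eqP ->; first by exists e.2.
by exists e.1; [rewrite edge_betweenC // adjC|rewrite adjC].
Qed.

Section Traversal.
Variables (X : set vertex) (C : subgraph).
Hypothesis hC : cycle_in X C.
Local Notation r s t := (edge_between s t \in C.2).

Lemma cycle_adj s t : r s t -> adj s t.
Proof. by have [hs _ _ _] := hC => /hs[]. Qed.

Lemma cycle_sym s t : r s t -> r t s.
Proof. by move=> st; rewrite edge_betweenC // adjC; apply: cycle_adj. Qed.

Lemma cycle_mem s t : r s t -> s \in C.1 /\ t \in C.1.
Proof.
have [hs _ _ _] := hC => /hs[_].
by case: (edge_between_pair s t) => -> /=.
Qed.

Lemma cycle_neighbours v : v \in C.1 ->
  exists s t, s != t /\ forall x, r v x = (x == s) || (x == t).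
Proof.
have [hs h2 _ _] := hC => /h2.
set F := [fset e in C.2 | endvertex v e]%fset => F2.
have inF e : (e \in F) = (e \in C.2) && endvertex v e by rewrite !inE.
case E: (enum_fset F) (F2) => [|e1 [|e2 []]] // _.
have memF e : (e \in F) = (e == e1) || (e == e2).
  by transitivity (e \in enum_fset F); rewrite // E !inE.
have e12 : e1 != e2.
  by have := fset_uniq F; rewrite E /= !inE andbT.
have : e1 \in F by rewrite memF eqxx.
rewrite inF => /andP[/hs[he1 _ _] /(edge_endvertex he1)[s es vs]].
have : e2 \in F by rewrite memF eqxx orbT.
rewrite inF => /andP[/hs[he2 _ _] /(edge_endvertex he2)[t et vt]].
exists s, t; split.
  by apply: contra_neq e12 => st; rewrite es et st.
have inj x y : adj v y -> (edge_between v x == edge_between v y) = (x == y).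
  move=> vy; apply/eqP/eqP => [|->//] /edge_between_inj[[_ //]|[vy' _]].
  by have := adj_neq vy; rewrite -vy' eqxx.
move=> x; transitivity (edge_between v x \in F).
  by rewrite inF endvertex_edge_between eqxx andbT.
by rewrite memF es et !inj.
Qed.

Lemma cycle_third v s t x : r v s -> r v t -> r v x -> s != t -> x = s \/ x = t.
Proof.
move=> vs vt vx; have [/cycle_neighbours[p [q [_ E]]] _] := cycle_mem vs.
move: vs vt vx; rewrite !E => /orP[]/eqP-> /orP[]/eqP-> /orP[]/eqP->;
  rewrite ?eqxx //; auto.
Qed.

Lemma cycle_other v s : r v s -> exists2 t, r v t & t != s.
Proof.
move=> vs; have [/cycle_neighbours[p [q [pq E]]] _] := cycle_mem vs.
move: vs; rewrite E => /orP[]/eqP->; [exists q|exists p]; rewrite ?E ?eqxx ?orbT //.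
by rewrite eq_sym.
Qed.

(** At each vertex one of its two neighbours in C is where the traversal came from, so the next
    vertex is forced. *)
Lemma closed_SAW_unique c c' : closed_SAW c -> closed_SAW c' -> size c = size c' ->
  (forall i, (i.+1 < size c)%N -> r (nv c i) (nv c i.+1)) ->
  (forall i, (i.+1 < size c)%N -> r (nv c' i) (nv c' i.+1)) ->
  nv c 0%N = nv c' 0%N -> nv c 1%N = nv c' 1%N -> c = c'.
Proof.
move=> hc hc' sz cr cr' e0 e1.
have turn d (hd : closed_SAW d) i : (i.+2 < size d)%N -> nv d i.+2 != nv d i.
  by move=> id; have := @closed_SAW_turn d hd i.+1; apply; lia.
suff E i : (i < size c)%N -> nv c i = nv c' i.
  by apply: (@eq_from_nth _ ((0, 0) : vertex)) => // i; apply: E.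
elim/ltn_ind: i => -[|[|i]] // IH ic.
have h1 := IH i.+1 (ltnSn _) (ltnW ic).
have h0 := IH i (ltnW (ltnSn _)) (ltnW (ltnW ic)).
have r1 : r (nv c i.+1) (nv c i) by apply/cycle_sym/cr; lia.
have r2 := cr i.+1 ic; have r3 := cr' i.+1 ic; rewrite -h1 in r3.
have ne := turn c hc i ic; have ne' := turn c' hc' i; rewrite -h0 -sz in ne'.
have [e|//] : nv c' i.+2 = nv c i \/ nv c' i.+2 = nv c i.+2.
  by apply: cycle_third r1 r2 r3 _; rewrite eq_sym.
by have := ne' ic; rewrite e eqxx.
Qed.

(** At each of its vertices c uses both edges of C. Its vertex set is thus closed under adjacency in
    C and, C being connected, exhausts C. *)
Lemma closed_SAW_subgraph c : closed_SAW c ->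
  (forall i, (i.+1 < size c)%N -> r (nv c i) (nv c i.+1)) ->
  subgraph_of_walk c = C.
Proof.
move=> hc cr; have [c3 _ _ ce] := hc.
have nbr i x : (i < (size c).-1)%N -> r (nv c i) x ->
    exists2 j, (j.+1 < size c)%N &
      edge_between (nv c i) x = edge_between (nv c j) (nv c j.+1) /\ x \in c.
  move=> iN rx; set p := cpred (size c).-1 i; have pN := cpred_lt hc iN;
    rewrite -/p in pN.
  have rp : r (nv c i) (nv c p).
    by apply: cycle_sym; rewrite -[X in edge_between _ X](closed_SAW_cpred hc iN)
      -/p; apply: cr; lia.
  have rs : r (nv c i) (nv c i.+1) by apply: cr; lia.
  have := cycle_third rs rp rx (closed_SAW_turn hc iN).
  case=> ->.
    exists i; first lia.
    by split=> //; apply/mem_nth_vertex; exists i.+1 => //; lia.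
  exists p; first lia.
  split; first by rewrite -[X in edge_between X _](closed_SAW_cpred hc iN) -/p
    edge_betweenC //; apply/cycle_adj; rewrite /p closed_SAW_cpred.
  by apply/mem_nth_vertex; exists p => //; lia.
have closedr u p : u \in c -> path (fun s t => r s t) u p -> last u p \in c.
  elim: p u => [|x p IH] u //= uc /andP[ux xp]; apply: IH xp.
  by have [i iN ui] := closed_SAW_mem hc uc; rewrite ui in ux;
    have [j _ []] := nbr i x iN ux.
have c1C v : v \in c -> v \in C.1.
  move=> /(closed_SAW_mem hc)[i iN ->].
  by have [|] := @cycle_mem (nv c i) (nv c i.+1); first by apply: cr; lia.
have c0 : nv c 0%N \in c by apply/mem_nth_vertex; exists 0%N => //; lia.
have [hs _ [_ conn] _] := hC.
have Cc v : (v \in C.1) = (v \in c).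
  apply/idP/idP; last exact: c1C.
  by move=> vC; have [p [pp <-]] := conn _ _ (c1C _ c0) vC; apply: closedr.
rewrite /subgraph_of_walk; case: (C) Cc nbr cr hs => C1 C2 /= Cc nbr cr hs.
congr pair; apply/fsetP => e; rewrite !inE //.
apply/idP/idP; first by move=> /walk_edgesP[i ic ->]; apply: cr.
move=> eC; have [he e1 e2] := hs e eC.
have [s es _] : exists2 s, e = edge_between e.1 s & adj e.1 s.
  by apply: edge_endvertex; rewrite // /endvertex eqxx.
rewrite Cc in e1; have [i iN ei] := closed_SAW_mem hc e1.
have [|j jc [ej _]] := nbr i s iN; first by rewrite -ei -es.
by apply/walk_edgesP; exists j => //; rewrite es ei.
Qed.

(** A path in C is prolonged until it returns to its start, which must happen since C is finite. *)
Lemma closed_SAW_exists v0 v1 : r v0 v1 ->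
  exists c, [/\ closed_SAW c, forall i, (i.+1 < size c)%N -> r (nv c i) (nv c i.+1),
    nv c 0%N = v0 & nv c 1%N = v1].
Proof.
move=> r01.
pose P (l : seq vertex) := [/\ (1 < size l)%N, uniq l, forall i, (i.+1 < size l)%N
  -> r (nv l i) (nv l i.+1),
   nv l 0%N = v0 & nv l 1%N = v1].
have Psize l : P l -> (size l <= #|` C.1|)%N.
  move=> [l1 lU lr _ _]; apply: (uniq_leq_size lU) => v /mem_nth_vertex[i il ->].
  case: i il => [|i] il; first by have [] := cycle_mem (lr 0%N l1).
  by have [] := cycle_mem (lr i il).
have step l : P l -> r (nv l (size l).-1) v0 /\ (2 < size l)%N \/ exists t, P
  (rcons l t).
  move=> Pl; have [l1 lU lr l0 lv1] := Pl.
  set k := (size l).-1; have kE : size l = k.+1 by rewrite /k; lia.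
  have k0 : (0 < k)%N by rewrite /k; lia.
  have rk : r (nv l k) (nv l k.-1).
    by apply/cycle_sym; have := lr k.-1; rewrite prednK // kE; apply.
  have [s rs sk] := cycle_other rk.
  have [/mem_nth_vertex[i il si]|snl] := boolP (s \in l); last first.
    right; exists s; split.
    - by rewrite size_rcons; lia.
    - by rewrite rcons_uniq snl lU.
    - move=> i; rewrite size_rcons => il; rewrite /nth_vertex !nth_rcons.
      have -> : (i < size l)%N by lia.
      case: ifP => il'; first exact: lr.
      have -> : i.+1 == size l by lia.
      by have -> : i = k by lia.
    - by rewrite /nth_vertex nth_rcons; have -> : (0 < size l)%N by lia.
    - by rewrite /nth_vertex nth_rcons l1.
  left; subst s.
  have lN a b : (a < size l)%N -> (b < size l)%N -> nv l a = nv l b -> a = b.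
    move=> al bl; exact: (uniqP ((0, 0) : vertex) lU).
  have ik : i != k.
    by apply/eqP => e; have := adj_neq (cycle_adj rs); rewrite e eqxx.
  have [i0|i0] := posnP i.
    subst i; rewrite -l0; split=> //.
    have : k != 1%N by apply/eqP => e; move: sk; rewrite e eqxx.
    lia.
  (* At an inner vertex s of l, the neighbours in C are those before and after it on l. The end of l
     would then be the vertex after s, so s would be the vertex from which the path came. *)
  exfalso.
  have rb : r (nv l i) (nv l i.-1).
    by apply/cycle_sym; have := lr i.-1; rewrite prednK //; apply.
  have rf : r (nv l i) (nv l i.+1) by apply: lr; lia.
  have ne : nv l i.-1 != nv l i.+1 by apply/eqP => /lN; lia.
  case: (cycle_third rb rf (cycle_sym rs) ne) => /lN.
    lia.
  move=> e; have {}e : k = i.+1 by apply: e; lia.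
  by move: sk; rewrite e eqxx.
suff [l [Pl rl l2]] : exists l, [/\ P l, r (nv l (size l).-1) v0 & (2 < size l)%N].
  have [l1 lU lr l0 lv1] := Pl.
  have nthE i : (i < size l)%N -> nv (rcons l v0) i = nv l i.
    by move=> il; rewrite /nth_vertex nth_rcons il.
  have nthL : nv (rcons l v0) (size l) = v0 by rewrite /nth_vertex nth_rcons ltnn eqxx.
  have cr i : (i.+1 < size (rcons l v0))%N ->
    r (nv (rcons l v0) i) (nv (rcons l v0) i.+1).
    rewrite size_rcons => il; have [e|ne] := eqVneq i.+1 (size l).
      by rewrite e nthL nthE; [have -> : i = (size l).-1 by lia|lia].
    by rewrite !nthE; try lia; apply: lr; lia.
  exists (rcons l v0); split=> //; [|by rewrite nthE //; lia|by rewrite nthE].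
  split; rewrite ?size_rcons; first lia.
  - by move=> i il; apply/cycle_adj/cr; rewrite size_rcons.
  - move=> i j ij; rewrite !nthE; try lia.
    by apply: (uniq_nth_vertex _ lU).
  - by rewrite [_.+1.-1]/= nthL nthE //; lia.
have P0 : P [:: v0; v1].
  split=> //; first by rewrite /= inE andbT; apply: adj_neq; apply: cycle_adj.
  by move=> [|i].
(* Here m bounds the number of further prolongations, as a path has at most as many vertices as
   C. *)
suff ind m l : P l -> (#|` C.1| < size l + m)%N ->
    exists l, [/\ P l, r (nv l (size l).-1) v0 & (2 < size l)%N].
  by apply: (ind #|` C.1| _ P0) => /=; lia.
elim: m l => [|m IH] l Pl lm; first by have := Psize l Pl; lia.
have [[rl l2]|[t Pt]] := step l Pl; first by exists l.
by apply: IH Pt _; rewrite size_rcons; lia.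
Qed.

End Traversal.

(** * Walks that close up *)

Lemma nth_vertex_take w j i : (i < j)%N -> nv (take j w) i = nv w i.
Proof. by move=> ij; rewrite /nth_vertex nth_take. Qed.

Lemma nth_vertex_drop w j i : nv (drop j w) i = nv w (j + i).
Proof. by rewrite /nth_vertex nth_drop. Qed.

Definition looping_paths (X : set vertex) (a : edge) (n : nat) : set (seq vertex) :=
  [set w | [/\ domain_paths X a n w, X (nv w n) & ~~ uniq w]].

Definition tailed_cycles (X : set vertex) (a : edge) (n : nat) :
    set (seq vertex * subgraph) :=
  [set p | [/\ domain_SAWs X a p.1, tail_cycles X p.1 p.2
             & (walk_length p.1 + #|` p.2.2|)%N = n]].

Definition loop_start (w : seq vertex) : nat := index (final_vertex w) w.

Definition loop_left (w : seq vertex) : bool :=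
  let j := loop_start w in hook_weight (nv w j.-1) (nv w j) (nv w j.+1) == 1.

(** The subgraph forgets the orientation of the loop; the boolean retains it as the side of the
    first turn off the tail. *)
Definition split_loop (w : seq vertex) : (seq vertex * subgraph) * bool :=
  ((take (loop_start w).+1 w, subgraph_of_walk (drop (loop_start w) w)), loop_left w).

Section LoopingPath.
Variables (X : set vertex) (a : edge) (n : nat) (w : seq vertex).
Hypothesis hw : looping_paths X a n w.
Local Notation j := (loop_start w).

Lemma looping_adj i : (i < n)%N -> adj (nv w i) (nv w i.+1).
Proof.
have [[/andP[/walkP[_ wA _] _] _ _ sw _] _ _] := hw.
by move=> iN; apply: wA; rewrite sw.
Qed.

Lemma looping_turn i : (i.+1 < n)%N -> nv w i != nv w i.+2.
Proof.
have [[/andP[/walkP[_ _ wN] _] _ _ sw _] _ _] := hw.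
by move=> iN; apply: wN; rewrite sw.
Qed.

Lemma looping_inj i k : (i < k < n)%N -> nv w i != nv w k.
Proof.
have [[/andP[_ wU] _ _ sw _] _ _] := hw; move: wU; rewrite walk_lengthE sw /=.
move=> /uniq_nth_vertex wU /andP[ik kn]; have := wU i k.
by rewrite size_take sw ltnSn !nth_vertex_take ?(ltn_trans ik kn) // ik kn; apply.
Qed.

Lemma looping_in i : (0 < i <= n)%N -> X (nv w i).
Proof.
have [[_ _ _ _ wX] wn _] := hw; move=> iN.
by have [->//|ne] := eqVneq i n; apply: wX; lia.
Qed.

Lemma looping_size : size w = n.+1.
Proof. by have [[]] := hw. Qed.

(** The walk starts outside X and ends in X, whence [0 < j]; adjacent vertices differ and backtracks
    are banned, so the loop has at least three edges. *)
Lemma loop_startP : [/\ (0 < j)%N, (j + 2 < n)%N & nv w j = nv w n].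
Proof.
have [[/andP[_ wU] _ wX _ _] wn nU] := hw.
have fw : final_vertex w = nv w n by rewrite /final_vertex looping_size.
have e : nv w j = nv w n.
  rewrite /loop_start fw /nth_vertex nth_index //.
  by apply/mem_nth_vertex; exists n; rewrite ?looping_size.
have jn : (j < n)%N.
  rewrite /loop_start fw; move: nU wU; have := looping_size; rewrite walk_lengthE.
  case/lastP: (w) => // u t; rewrite size_rcons => -[su].
  rewrite rcons_uniq -su /= -cats1 take_size_cat // => nU uU.
  have tu : t \in u by move: nU; rewrite uU andbT negbK.
  by rewrite /nth_vertex nth_cat ltnn subnn /= index_cat tu index_mem.
have j0 : (0 < j)%N.
  by rewrite lt0n; apply/eqP => j0; apply: wX; rewrite /first_vertex -j0 e.
split=> //; have [h1|h1] := eqVneq j.+1 n.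
  by have := adj_neq (looping_adj jn); rewrite h1 e eqxx.
have [h2|h2] := eqVneq j.+2 n; last lia.
have h3 : (j.+1 < n)%N by lia.
by have := looping_turn h3; rewrite h2 e eqxx.
Qed.

Lemma closed_SAW_loop : closed_SAW (drop j w).
Proof.
have [j0 jn e] := loop_startP; have sz : size (drop j w) = (n.+1 - j)%N.
  by rewrite size_drop looping_size.
split; rewrite ?sz; first lia.
- by move=> i ?; rewrite !nth_vertex_drop addnS; apply: looping_adj; lia.
- by move=> i k ?; rewrite !nth_vertex_drop; apply: looping_inj; lia.
- by rewrite !nth_vertex_drop addn0 e; congr (nv w _); lia.
Qed.

Lemma loop_mem v : v \in drop j w -> exists2 i, (j <= i < n)%N & v = nv w i.
Proof.
have [j0 jn e] := loop_startP.
move=> /(closed_SAW_mem closed_SAW_loop)[k]; rewrite size_drop looping_size => kN ->.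
by exists (j + k)%N; [lia|rewrite nth_vertex_drop].
Qed.

Lemma size_tail : size (take j.+1 w) = j.+1.
Proof.
by have [j0 jn e] := loop_startP; rewrite size_take looping_size; case: ifP => //; lia.
Qed.

Lemma split_loop_in : tailed_cycles X a n (split_loop w).1.
Proof.
have [j0 jn e] := loop_startP; have st := size_tail.
have tU : uniq (take j.+1 w).
  apply/uniq_nth_vertex; rewrite st => i k ik.
  by rewrite !nth_vertex_take; [apply: looping_inj| |]; lia.
have tW : walk (take j.+1 w).
  apply/walkP; rewrite st; split; first lia.
    by move=> i ?; rewrite !nth_vertex_take; [apply: looping_adj| |]; lia.
  by move=> i ?; rewrite !nth_vertex_take; [apply: looping_turn| |]; lia.
have [[_ wa wX _ wXi] _ _] := hw.
split=> /=.
- suff [] : domain_SAWs_of_length X a j (take j.+1 w) by [].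
  apply/domain_SAWs_ofE => //; split=> //; last first.
    by rewrite nth_vertex_take //; apply: looping_in; lia.
  split=> //.
  + by rewrite /weak_SAW tW take_uniq.
  + by move: wa; rewrite /first_edge /first_vertex !nth_vertex_take.
  + by rewrite /first_vertex nth_vertex_take.
  + by move=> i ?; rewrite nth_vertex_take; [apply: looping_in|]; lia.
- split.
    apply: (subgraph_cycle_in closed_SAW_loop) => v /loop_mem[i iN ->].
    by apply: looping_in; lia.
  have fE : final_vertex (take j.+1 w) = nv w j.
    by rewrite /final_vertex st nth_vertex_take.
  move=> v; rewrite inE fE; apply/andP/eqP => [[/loop_mem[i iN ->]]|->].
    move=> /mem_nth_vertex[k]; rewrite st => kj; rewrite nth_vertex_take // => ik.
    have [<-//|kj'] := eqVneq k j.
    by have := looping_inj (_ : k < i < n)%N; rewrite ik eqxx => /(_ (ltac:(lia))).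
  split; apply/mem_nth_vertex.
    by exists 0%N; rewrite ?nth_vertex_drop ?addn0 // size_drop looping_size; lia.
  by exists j; rewrite ?st // nth_vertex_take.
- rewrite card_subgraph_of_walk; last exact: closed_SAW_loop.
  by rewrite walk_lengthE st size_drop looping_size; lia.
Qed.

End LoopingPath.

(** Equal tails reach the loop along the same edge, equal sides then give the same first step, and
    [closed_SAW_unique] forces the rest. *)
Lemma split_loop_inj X a n : {in looping_paths X a n &, injective split_loop}.
Proof.
move=> w w' /set_mem hw /set_mem hw' [e1 e2 e3 e4].
have [j0 jn wj] := loop_startP hw; have [j0' jn' wj'] := loop_startP hw'.
have ej : loop_start w = loop_start w'.
  by have := congr1 size e1; rewrite (size_tail hw) (size_tail hw') => -[].
rewrite -ej in e1 e2 e3 jn' wj'.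
have e0 i : (i <= loop_start w)%N -> nv w i = nv w' i.
  by move=> ij; rewrite -(@nth_vertex_take w (loop_start w).+1) // e1 nth_vertex_take.
have hc := closed_SAW_loop hw; have hc' := closed_SAW_loop hw'; rewrite -ej in hc'.
have hC : cycle_in X (subgraph_of_walk (drop (loop_start w) w)).
  apply: (subgraph_cycle_in hc) => v /(loop_mem hw)[i iN ->].
  by apply: (looping_in hw); lia.
suff ed : drop (loop_start w) w = drop (loop_start w) w'.
  apply: (@eq_from_nth _ ((0, 0) : vertex));
    rewrite (looping_size hw) ?(looping_size hw') //.
  move=> i iN; have [ij|ji] := leqP i (loop_start w); first exact: e0.
  by rewrite -!/(nv _ _) -(subnKC (ltnW ji)) -!nth_vertex_drop ed.
have r1 i : (i.+1 < size (drop (loop_start w) w))%N ->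
    edge_between (nv (drop (loop_start w) w) i) (nv (drop (loop_start w) w) i.+1) \in
    (subgraph_of_walk (drop (loop_start w) w)).2.
  by move=> iN; rewrite inE; apply/walk_edgesP; exists i.
apply: (closed_SAW_unique hC) => //;
  rewrite ?size_drop ?(looping_size hw) ?(looping_size hw') //.
- move=> i; rewrite -(looping_size hw') -size_drop => iN.
  by rewrite /subgraph_of_walk /= e3 inE; apply/walk_edgesP; exists i.
- by rewrite !nth_vertex_drop addn0 e0.
- have ja : adj (nv w (loop_start w).-1) (nv w (loop_start w)).
    by have := looping_adj hw (_ : (loop_start w).-1 < n)%N; rewrite prednK //;
      apply; lia.
  rewrite !nth_vertex_drop addn1 (@third_onto _ _ (nv w (loop_start w).+1) ja);
    last 2 first.
  + by apply: (looping_adj hw); lia.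
  + by have := looping_turn hw (_ : (loop_start w).-1.+1 < n)%N;
    rewrite prednK // eq_sym; apply; lia.
  move: e4; rewrite /loop_left -ej => ->.
  rewrite !e0 //; last exact: leq_pred.
  rewrite -third_onto //.
  + by rewrite -!e0 // leq_pred.
  + by apply: (looping_adj hw'); lia.
  + by have := looping_turn hw' (_ : (loop_start w).-1.+1 < n)%N;
    rewrite prednK // eq_sym; apply; lia.
Qed.

Lemma split_loop_onto X a n : border X a ->
  tailed_cycles X a n `*` [set: bool] `<=` split_loop @` looping_paths X a n.
Proof.
move=> ha; suff H (u : seq vertex) (C : subgraph) (b : bool) :
    tailed_cycles X a n (u, C) ->
    exists2 w, looping_paths X a n w & split_loop w = ((u, C), b).
  by move=> [[u C] b] /= [uC _]; apply: H.
move=> [/= uS [hC uC] un].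
have [/andP[/walkP[u1 uA uN] uU] ua uX ubX] := uS.
set j := walk_length u in un; have jE : (size u).-1 = j by rewrite /j walk_lengthE.
have su : size u = j.+1 by move: u1 jE; case: (size u) => // k _ /= ->.
have fu : final_vertex u = nv u j by rewrite /final_vertex jE.
set p := nv u j.-1; set v0 := nv u j.
have j0 : (0 < j)%N by move: u1; rewrite su.
have pv0 : adj p v0 by have := uA j.-1; rewrite prednK // su; apply; lia.
have uin i : (i < size u)%N -> nv u i \in u by move=> iu; apply/mem_nth_vertex;
  exists i.
have v0C : v0 \in C.1.
  by have := uC v0; rewrite fu -/v0 eqxx => /andP[].
have uC' i : (i < j)%N -> nv u i \notin C.1.
  move=> ij; have := uC (nv u i); rewrite uin ?su ?andbT ?fu; last lia.
  by move=> ->; apply: (uniq_nth_vertex _ uU); rewrite su; lia.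
(* The two neighbours of v0 in C differ from p, which is off C, so they are the left and the right
   turn; whichever b asks for is available. *)
have r01 : edge_between v0 (third p v0 b) \in C.2.
  have [s [t [st E]]] := cycle_neighbours hC v0C.
  have side x : (x == s) || (x == t) -> x = third p v0 (hook_weight p v0 x == 1).
    rewrite -E => v0x; apply: third_onto => //; first exact: (cycle_adj hC).
    apply/eqP => xp; have [_] := cycle_mem hC v0x; rewrite xp.
    by apply/negP; apply: uC'; lia.
  have es : s = third p v0 (hook_weight p v0 s == 1) by apply: side; rewrite eqxx.
  have et : t = third p v0 (hook_weight p v0 t == 1) by apply: side; rewrite eqxx orbT.
  have ne : (hook_weight p v0 s == 1) != (hook_weight p v0 t == 1).
    by apply: contra_neq st => e; rewrite es et e.
  rewrite E [X in (_ == X) || _]es [X in _ || (_ == X)]et.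
  by move: ne; case: b; case: (_ s == 1); case: (_ t == 1); rewrite ?eqxx ?orbT.
have [c [hc cr c0 c1]] := closed_SAW_exists hC r01.
have [c3 cA cN ce] := hc.
have cC : subgraph_of_walk c = C := closed_SAW_subgraph hC hc cr.
have sC : #|` C.2| = (size c).-1 by rewrite -cC card_subgraph_of_walk.
(* The tail u already ends in v0, with which c begins. *)
pose w := u ++ behead c.
have sw : size w = n.+1 by rewrite /w size_cat size_behead su -un sC; lia.
have wu i : (i <= j)%N -> nv w i = nv u i.
  by move=> ij; rewrite /nth_vertex nth_cat su ltnS ij.
have wc i : nv w (j + i) = nv c i.
  case: i => [|i]; first by rewrite addn0 wu // c0.
  rewrite /nth_vertex nth_cat su; have -> : (j + i.+1 < j.+1)%N = false by lia.
  rewrite nth_behead.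
  by have -> : (j + i.+1 - j.+1 = i)%N by lia.
have nE : n = (j + (size c).-1)%N by rewrite -un sC.
have wA i : (i < n)%N -> adj (nv w i) (nv w i.+1).
  move=> iN; have [ij|ji] := ltnP i j; first by rewrite !wu //; [apply: uA; lia|lia].
  by rewrite -(subnKC ji) -addnS !wc; apply: cA; lia.
have cX k : (k < size c)%N -> nv c k \in C.1.
  by move=> kc; rewrite -cC inE; apply/mem_nth_vertex; exists k.
have wN i k : (i < k < n)%N -> nv w i != nv w k.
  move=> ik; have [kj|jk] := leqP k j.
    by rewrite !wu; [apply: (uniq_nth_vertex _ uU); lia|lia|lia].
  have [ij|ji] := ltnP i j.
    rewrite wu; last lia.
    apply/eqP => e; have := uC' i ij; rewrite e -(subnKC (ltnW jk)) wc cX //; lia.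
  by rewrite -(subnKC (ltnW jk)) -(subnKC ji) !wc; apply: cN; lia.
have wn : nv w n = v0 by rewrite nE wc ce.
have wturn i : (i.+1 < n)%N -> nv w i != nv w i.+2.
  move=> iN; have [e|ne] := eqVneq i.+2 n; last by apply: wN; lia.
  rewrite e nE wc ce -(wc 0%N) addn0 eq_sym; apply: wN; lia.
have wX i : (0 < i <= n)%N -> X (nv w i).
  move=> iN; have [ij|ji] := leqP i j.
    have ei : i = i.-1.+1 by lia.
    rewrite wu //; apply: ubX; rewrite ei /nth_vertex -nth_behead; apply: mem_nth;
      rewrite size_behead su; lia.
  rewrite -(subnKC (ltnW ji)) wc; have [_ _ _] := hC; apply; apply: cX; lia.
have wW : walk w.
  by apply/walkP; rewrite sw; split=> // ; lia.
have wl : loop_start w = j.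
  rewrite /loop_start /final_vertex sw /= wn /w index_cat.
  have -> : v0 \in u by apply: uin; rewrite su.
  by rewrite /v0 /nth_vertex index_uniq ?su.
have hw : looping_paths X a n w.
  split.
  - split=> //.
    + rewrite /weak_SAW wW walk_lengthE sw; apply/uniq_nth_vertex => i k.
      rewrite size_take sw ltnSn => ik; rewrite !nth_vertex_take; [exact: wN|lia|lia].
    + by move: ua; rewrite /first_edge /first_vertex !wu.
    + by rewrite /first_vertex wu.
    + by move=> i ?; apply: wX; lia.
  - by apply: wX; lia.
  - apply/negP => /uniq_nth_vertex/(_ j n).
    by rewrite wn wu // eqxx sw => H; have := H (ltac:(lia)).
have dw : drop j w = c.
  rewrite /w drop_cat su ltnSn.
  have -> : drop j u = [:: v0].
    by rewrite (drop_nth ((0, 0) : vertex)) ?su // drop_oversize ?su.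
  by case: (c) c0 c3 => //= x s ->.
exists w => //; rewrite /split_loop wl dw cC; congr (_, _, _).
  by rewrite /w take_cat su ltnn subnn take0 cats0.
rewrite /loop_left wl wu ?leq_pred // wu // -addn1 wc c1.
by have [_ _ ->] := thirdP b pv0; case: (b).
Qed.

Lemma set_bij_split_loop X a n : border X a ->
  set_bij (looping_paths X a n) (tailed_cycles X a n `*` [set: bool]) split_loop.
Proof.
move=> ha; split; [|exact: split_loop_inj|exact: split_loop_onto].
by move=> w hw; split=> //; apply: split_loop_in.
Qed.

(** * Winding numbers and directions *)

Lemma reachable_cons A u v t : adj u v -> A u -> reachable A v t -> reachable A u t.
Proof.
move=> uv Au [p [vp pt pA]]; exists (v :: p); split=> //=; first by rewrite uv.
by move=> s; rewrite inE => /predU1P[->//|]; apply: pA.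
Qed.

(** Serves to show that the vertex just before a loop lies in an infinite component off the loop:
    the tail leads back from it to the start outside X. *)
Lemma infinite_component A B (v : nat -> vertex) k :
  A `<=` B -> infinite_set (component_in_H A (v 0%N)) ->
  (forall i, (i < k)%N -> adj (v i) (v i.+1)) ->
  (forall i, (i <= k)%N -> B (v i)) ->
  infinite_set (component_in_H B (v k)).
Proof.
move=> AB Ainf vA vB; apply: sub_infinite_set Ainf => q.
rewrite /component_in_H /= => Aq; have {Aq} Bq : reachable B (v 0%N) q.
  by case: Aq => p [pp pq pA]; exists p; split=> // t /pA/AB.
elim: k vA vB => // k IH vA vB; apply: (@reachable_cons _ _ (v k)).
- by rewrite adjC; apply: vA.
- exact: vB.
- by apply: IH => i ?; [apply: vA|apply: vB]; lia.
Qed.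

Lemma turning_cat v m n : (0 < m)%N -> (0 < n)%N ->
  turning v (m + n) = turning v m + hook_weight (v m.-1) (v m) (v m.+1) +
    turning (fun i => v (m + i)%N) n.
Proof.
case: m n => // m [|n] // _ _; rewrite /turning addSn addnS /=.
rewrite (@big_cat_nat _ _ _ m.+1) //=; last lia.
rewrite big_nat_recr //=; congr (_ + _).
rewrite -{1}[m.+1]add0n big_addn.
have -> : ((m + n).+1 - m.+1 = n)%N by lia.
by apply: eq_bigr => i _; rewrite addnC !addnS.
Qed.

Lemma eq_turning v v' n : (forall i, (i <= n)%N -> v i = v' i) ->
  turning v n = turning v' n.
Proof.
move=> e; apply: eq_big_nat => i ?; rewrite !e //; lia.
Qed.

(** The walk is cut at the start of the loop. The vertex before it is joined off the loop to an
    infinite component of the complement of X, so the loop has index 0 about it and [turning_cycle]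
    applies. *)
Lemma winding_split_loop X a n w : simple_domain X -> looping_paths X a n w ->
  winding w = winding (split_loop w).1.1 + if loop_left w then - 4 else 4.
Proof.
move=> [_ hX] hw; have [j0 jn wj] := loop_startP hw.
set j := loop_start w in j0 jn wj; set c := drop j w.
have hc : closed_SAW c := closed_SAW_loop hw.
have cE i : nv c i = nv w (j + i) by rewrite nth_vertex_drop.
have [m mE] : exists m, n = (j + m)%N by exists (n - j)%N; lia.
rewrite !windingE !walk_lengthE (looping_size hw) /= (size_tail hw) /= -/j.
rewrite [in LHS]mE turning_cat //; last lia.
rewrite -addrA (@eq_turning (nv w) (nv (take j.+1 w)) j); last first.
  by move=> i ij; rewrite nth_vertex_take.
congr (_ + _); rewrite (@eq_turning _ (nv c) m); last by move=> i _; rewrite cE.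
set p := nv w j.-1.
have pc i : (i < m)%N -> p != nv c i.
  by move=> ic; rewrite cE; apply: (looping_inj hw); lia.
have pa : adj p (nv c 0%N).
  rewrite cE addn0; have := looping_adj hw (_ : j.-1 < n)%N; rewrite prednK //;
    apply; lia.
have cA i : (i < m)%N -> adj (nv c i) (nv c i.+1).
  by move=> ?; rewrite !cE addnS; apply: (looping_adj hw); lia.
have ce : nv c m = nv c 0%N by rewrite !cE addn0 -mE wj.
have pinf : infinite_set (component_in_H (~` [set v | v \in c]) p).
  apply: (@infinite_component (~` X)).
  - move=> v nX /= /(loop_mem hw)[k kN vk]; apply: nX; rewrite vk;
    apply: (looping_in hw).
    by rewrite -/j in kN; lia.
  - by apply: hX; have [[]] := hw.
  - by move=> i ?; apply: (looping_adj hw); lia.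
  - move=> i ij /= /(loop_mem hw)[k kN ik]; rewrite -/j in kN.
    by have := looping_inj hw (_ : i < k < n)%N; rewrite ik eqxx => H;
      have := H (ltac:(lia)).
have sw0 : sweep p (nv c) 0 m = 0.
  (* Comparison with the constant walk at the base point, whose sweep is an empty sum. *)
  rewrite (@sweep_unique [set v | v \in c] (nv c) (fun=> nv c 0%N) 0 m 0 0) //=.
  - by rewrite /sweep big_geq.
  - by move=> i ?; apply/adj_step/cA; lia.
  - move=> i ?; apply/mem_nth_vertex; exists i => //.
    by rewrite size_drop (looping_size hw); lia.
  - move=> i ?; apply/mem_nth_vertex; exists 0%N => //.
    by rewrite size_drop (looping_size hw); lia.
rewrite addrC -[nv w j](congr1 (nv w) (addn0 j)) -[nv w j.+1](congr1 (nv w) (addn1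
  j)) -!cE.
rewrite turning_cycle //; [|lia|].
- by rewrite /loop_left -/j -/p /hook_weight !cE addn0 addn1; case: ifP.
- by move=> i k ?; rewrite !cE; apply: (looping_inj hw); lia.
Qed.

Lemma border_endvertices X e u v : border X e -> e = edge_between u v -> X u ->
  u = inner_endvertex X e /\ v = outer_endvertex X e.
Proof.
rewrite /border /inner_endvertex /outer_endvertex => -[_ he] ee Xu; move: he;
  rewrite ee.
by case: (edge_between_pair u v) => -> /= -[[? ?]|[? ?]]; case: asboolP.
Qed.

(** * Walks between two border edges *)

Section DomainWalks.
Variables (X : set vertex) (a e : edge).
Hypotheses (ha : border X a) (he : border X e).

Lemma domain_walks_in w i : domain_walks X a e w -> (0 < i < walk_length w)%N ->
  X (nv w i).
Proof.
move=> [_ _ _ _ wX]; rewrite walk_lengthE => iw; apply: contrapT => nX.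
by have := wX i; case=> //; lia.
Qed.

Lemma domain_walks_inj w i j : domain_walks X a e w -> (i < j < walk_length w)%N ->
  nv w i != nv w j.
Proof.
move=> [/andP[_ wU] _ _ _ _] /andP[ij jw].
have jw' : (j < size (take (walk_length w) w))%N.
  by rewrite size_take; case: ifP => // _; move: jw; rewrite walk_lengthE; lia.
have := uniq_nth_vertex _ wU i j; rewrite ij jw'.
by rewrite !nth_vertex_take ?(ltn_trans ij jw) //; apply.
Qed.

Lemma domain_walks_first w : domain_walks X a e w ->
  nv w 0%N = outer_endvertex X a /\ nv w 1%N = inner_endvertex X a.
Proof. by move=> [_ wa wX _ _]; apply: first_edge_border. Qed.

Lemma domain_walks_last w : domain_walks X a e w -> (1 < walk_length w)%N ->
  nv w (walk_length w).-1 = inner_endvertex X e /\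
  nv w (walk_length w) = outer_endvertex X e.
Proof.
move=> hw w1; have [_ _ _ we _] := hw.
apply: border_endvertices => //; last by apply: (domain_walks_in hw); lia.
by rewrite -we /final_edge /final_vertex !walk_lengthE.
Qed.

(** A longer walk with final edge a would leave X along it and so be at the inner endvertex of a
    both at position 1 and just before the end. This repeats a vertex or, for length 2, is a
    backtrack. *)
Lemma domain_walks_trivial w : domain_walks X a e w ->
  (walk_length w == 1%N) = (e == a).
Proof.
move=> hw; have [/andP[wW wU] wa _ we _] := hw.
have [s1 wA wN] := walkP _ wW.
have [w0 w1] := domain_walks_first hw.
apply/eqP/eqP => [w1'|ea].
  rewrite -wa -we /final_edge /first_edge /final_vertex.
  by move: w1'; rewrite walk_lengthE; case: (w) => [|? [|? []]].
apply: contrapT => n1; have n2 : (1 < walk_length w)%N.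
  by move: s1 n1; rewrite walk_lengthE; lia.
have [] := domain_walks_last hw n2; rewrite ea -w0 -w1 => e1 e2.
have [n2'|n2'] := eqVneq (walk_length w) 2%N.
  have s3 : (2 < size w)%N by move: n2'; rewrite walk_lengthE; lia.
  have := wN 0%N s3; have -> : nv w 2%N = nv w (walk_length w) by rewrite n2'.
  by rewrite e2 eqxx.
have := domain_walks_inj hw (_ : 1 < (walk_length w).-1 < walk_length w)%N.
by rewrite e1 eqxx => H; have := H (ltac:(lia)).
Qed.

Lemma winding_unique w w' : simple_domain X ->
  domain_walks X a e w -> domain_walks X a e w' -> winding w = winding w'.
Proof.
move=> [_ hX] hw hw'; rewrite !windingE.
have [w0 w1] := domain_walks_first hw; have [w0' w1'] := domain_walks_first hw'.
have [ea|ea] := eqVneq e a.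
  have := domain_walks_trivial hw; have := domain_walks_trivial hw'.
  by rewrite ea eqxx => /eqP -> /eqP ->; rewrite /turning !big_geq.
have pos v : domain_walks X a e v -> (1 < walk_length v)%N.
  move=> hv; have := domain_walks_trivial hv; rewrite (negbTE ea).
  by have [/andP[/walkP[s1 _ _] _] _ _ _ _] := hv; move: s1; rewrite walk_lengthE; lia.
have [wl wl'] := domain_walks_last hw (pos _ hw).
have [wl1 wl1'] := domain_walks_last hw' (pos _ hw').
(* [turning_unique] starts at length 3. If one walk has length 2, then a and e share their inner
   endvertex, which a longer walk would visit twice. *)
have two v v' : domain_walks X a e v -> domain_walks X a e v' ->
    walk_length v = 2%N -> walk_length v' = 2%N.
  move=> hv hv' v2; have [_ v1] := domain_walks_first hv;
    have [_ v1'] := domain_walks_first hv'.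
  have [vl _] := domain_walks_last hv (pos _ hv).
  have [vl' _] := domain_walks_last hv' (pos _ hv').
  rewrite v2 -[2.-1%N]/1%N v1 -v1' -vl' in vl; have := pos _ hv'.
  have := domain_walks_inj hv' (_ : 1 < (walk_length v').-1 < walk_length v')%N.
  rewrite vl eqxx => H; have [//|n2] := eqVneq (walk_length v') 2%N.
  by move=> v2'; have := H (ltac:(lia)).
have [w2|w2] := eqVneq (walk_length w) 2%N.
  have w2' := two _ _ hw hw' w2.
  rewrite w2 w2' in wl wl' wl1 wl1' *.
  by rewrite /turning !big_nat1 w0 w0' w1 w1' wl' wl1'.
have w2' : walk_length w' != 2%N by apply: contra_neq w2; apply: two.
have nX : ~ X (outer_endvertex X e).
  have [_ he'] := he; rewrite /outer_endvertex; case: asboolP; move: he'; tauto.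
have lA v : domain_walks X a e v -> forall i, (i < walk_length v)%N ->
  adj (nv v i) (nv v i.+1).
  move=> [/andP[/walkP[s1 vA _] _] _ _ _ _] i; rewrite walk_lengthE => iv;
    apply: vA; lia.
have := pos _ hw; have := pos _ hw' => p' p.
apply: (@turning_unique X).
- lia.
- lia.
- exact: lA.
- exact: lA.
- by move=> i j; apply: domain_walks_inj.
- by move=> i j; apply: domain_walks_inj.
- by move=> i; apply: domain_walks_in.
- by move=> i; apply: domain_walks_in.
- by apply: hX; have [] := hw.
- by rewrite wl'; apply: hX.
- by rewrite wl'.
- by rewrite w0 w0'.
- by rewrite w1 w1'.
- by rewrite wl wl1.
- by rewrite wl' wl1'.
Qed.

Lemma border_windingE w : simple_domain X ->
  domain_walks X a e w -> border_winding X a e = winding w.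
Proof.
move=> sX hw; rewrite /border_winding.
(* The default 0 of [xget] is not taken, since w makes the set non-empty. *)
have [|v hv <-] := @xgetPex _ (0 : int) [set winding v | v in domain_walks X a e].
  by exists (winding w), w.
exact: winding_unique.
Qed.

End DomainWalks.

Lemma winding_rcons w t : (1 < size w)%N ->
  winding (rcons w t) =
  winding w + hook_weight (nv w (size w).-2) (nv w (size w).-1) t.
Proof.
move=> w1; have [k kE] : exists k, size w = k.+2 by exists (size w).-2; lia.
have e i : (i < k.+2)%N -> nv (rcons w t) i = nv w i.
  by move=> ik; rewrite /nth_vertex nth_rcons kE ik.
have eL : nv (rcons w t) k.+2 = t by rewrite /nth_vertex nth_rcons kE ltnn eqxx.
rewrite !windingE !walk_lengthE size_rcons kE /turning big_nat_recr //.
rewrite eL !e //; congr (_ + _).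
by apply: eq_big_nat => i ik; rewrite !e //; lia.
Qed.

(** * Directions as powers of zeta *)

Section Ell.
Variable R : realType.
Local Notation z := (zeta R).

Lemma zeta3 : z ^+ 3 = -1.
Proof.
rewrite /zeta; set t := (2 * pi / 6 : R).
(* The real and imaginary parts of the cube are the cosine and sine of 3t, here expanded by the
   addition formulas. *)
have tE : t + (t + t) = pi by rewrite /t; field.
have c3 := congr1 cos tE; have s3 := congr1 sin tE.
rewrite cospi !cosD !sinD in c3; rewrite sinpi !sinD !cosD in s3.
rewrite !exprS expr0 mulr1; apply/eqP; rewrite eq_complex /=.
apply/andP; split; apply/eqP.
  by apply: etrans c3; ring.
by rewrite oppr0; apply: etrans s3; ring.
Qed.

Lemma zeta_neq0 : z != 0.
Proof. by apply/eqP => z0; have /eqP := zeta3;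
  rewrite z0 expr0n /= eq_sym oppr_eq0 oner_eq0. Qed.

(** The sign appears because the edge is oriented away from v, against the step from u. The
    exponents 3, 4, 5 reduce to basic directions by [zeta3]. *)
Lemma ell_angle u v : adj u v -> ell R (edge_between u v) v = - z ^ angle u v.
Proof.
have z4 : z ^+ 4 = - z by rewrite exprSr zeta3 mulN1r.
have z5 : z ^+ 5 = - z ^+ 2 by rewrite -[5%N]/(3 + 2)%N exprD zeta3 mulN1r.
rewrite -mem_cw_neighbours.
case: u => [x y]; rewrite /cw_neighbours /even_vertex /angle /=.
case: ifPn => Ha; rewrite !inE => /or3P[] /eqP->;
  rewrite /above /below /left_of /right_of /=;
  rewrite /ell /ell_basic /edge_between /is_edge /vertical /horizontal /even_vertex
    /above /right_of /=;
  decide_ifs.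
- by [].
- by rewrite expr0z.
- by rewrite -[z ^ 4]/(z ^+ 4) z4 opprK.
- by rewrite expr1z.
- by rewrite -[z ^ 5]/(z ^+ 5) z5 opprK.
- by rewrite -[z ^ 3]/(z ^+ 3) zeta3 opprK.
Qed.

Lemma ell_opp e u v : e = (u, v) \/ e = (v, u) -> u != v -> ell R e u = - ell R e v.
Proof.
by move=> [->|->] uv; rewrite /ell /= eqxx ?(negbTE uv) // eq_sym (negbTE uv) ?opprK.
Qed.

Lemma zeta6X (k : int) : z ^ (6 * k) = 1.
Proof.
rewrite -exprz_exp -[z ^ 6]/(z ^+ (3 * 2)) exprM zeta3 sqrrN expr1n.
exact: exp1rz.
Qed.

(** The winding number is the change of angle modulo 6, and the sixth power of zeta is 1. *)
Lemma ell_walkE w : walk w ->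
  ell_walk R w = ell R (first_edge w) (nth_vertex w 1) * z ^ winding w.
Proof.
move=> /walkP[w1 wA wN]; rewrite /ell_walk /first_edge /final_edge /first_vertex
  /final_vertex.
have [n nE] : exists n, size w = n.+2 by exists (size w).-2; lia.
rewrite windingE walk_lengthE nE -[n.+2.-2]/n -[n.+2.-1]/n.+1.
rewrite !ell_angle; [|by apply: wA; rewrite nE..].
rewrite turning_corner //; last 2 first.
- by move=> i ?; apply: wA; lia.
- by move=> i ?; apply: wN; lia.
set A := angle _ _; set B := angle _ _; set S := \sum_(_ <= _ < _) _.
rewrite mulNr -expfzDr ?zeta_neq0 //.
have -> : B + (A - B + 6 * S) = A + 6 * S by lia.
by rewrite expfzDr ?zeta_neq0 // zeta6X mulr1.
Qed.
End Ell.

(** * Power series *)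

Section PowerSeries.
Variable A : comNzRingType.

Lemma fps_coefXn k n : fps_coef (fpsX A ^+ k) n = (n == k)%:R.
Proof.
elim: k n => [|k IH] n; first by rewrite expr0.
rewrite exprS; case: n => [|n] /=.
  by rewrite big_ord_recl big_ord0 mul0r addr0.
rewrite !big_ord_recl /= mul0r add0r mul1r IH big1 ?addr0 => [|i _];
  last by rewrite mul0r.
by rewrite subSS subn0.
Qed.

Lemma fps_coef_linear_mul (c : A) f n :
  fps_coef ((1 + c *: fpsX A) * f) n.+1 = fps_coef f n.+1 + c * fps_coef f n.
Proof.
rewrite /= !big_ord_recl /= big1 => [|i _]; last by rewrite /= mulr0 addr0 mul0r.
by rewrite mulr0 !addr0 mul1r add0r mulr1 subn0 /bump /= subn1.
Qed.

Lemma fps_coef0_linear_mul (c : A) f :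
  fps_coef ((1 + c *: fpsX A) * f) 0 = fps_coef f 0.
Proof. by rewrite /= big_ord_recl big_ord0 /= mulr0 !addr0 mul1r. Qed.

(** The factor [(n == len w)%:R] is the coefficient of x^n in the monomial x^(len w). *)
Lemma fsbig_length (T : choiceType) (D : set T) (len : T -> nat) (F : T -> A) n :
  \sum_(w \in D) F w * (n == len w)%:R = \sum_(w \in D `&` [set w | len w = n]) F w.
Proof.
rewrite fsbig_mkcondr; apply: eq_fsbigr => w _; rewrite eq_sym.
have [e|ne] := eqVneq (len w) n; first by rewrite mulr1 ifT // inE.
by rewrite mulr0 ifF //; apply/negbTE; rewrite notin_setE /=; apply/eqP.
Qed.

(** D may be infinite, as the border of X can be; only the finitely many indices in the image of B
    have a non-empty inner sum. *)
Lemma fsbig_fibers (T I : choiceType) (B : set T) (D : set I) (h : T ->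
  I) (F : T -> A) :
  finite_set B ->
  \sum_(i \in D) \sum_(w \in B `&` [set w | h w = i]) F w =
  \sum_(w \in B `&` h @^-1` D) F w.
Proof.
move=> finB; pose E := D `&` h @` B.
have finE : finite_set E by apply: finite_setIr; apply: finite_image.
transitivity (\sum_(i \in E) \sum_(w \in B `&` [set w | h w = i]) F w).
  apply/esym/fsbig_widen => [i []//|i [Di nEi]];
    rewrite /= [B `&` _](_ : _ = set0) ?fsbig_set0 //.
  by apply/seteqP; split=> // w [Bw hw]; apply: nEi; split=> //; exists w.
under eq_fsbigr do rewrite fsbig_mkcondr.
rewrite exchange_fsbig // fsbig_mkcondr; apply: eq_fsbigr => w /set_mem Bw.
have [/set_mem Dhw|nD] := boolP (w \in h @^-1` D).
  have Ehw : E (h w) by split=> //; exists w.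
  rewrite (fsbigD1 (h w)) //=.
  rewrite [X in X + _]ifT ?inE // [X in _ + X]fsbig1 ?addr0 // => i [_ ne].
  by rewrite ifF //; apply/negbTE; rewrite notin_setE /= => e; apply: ne.
rewrite fsbig1 // => i [Di _]; rewrite ifF //; apply/negbTE.
by apply: contraNN nD => /set_mem/= e; apply/mem_set; rewrite /= e.
Qed.

Lemma fsbig_bool (T : choiceType) (D : set T) (F : T -> bool -> A) : finite_set D ->
  \sum_(p \in D `*` [set: bool]) F p.1 p.2 = \sum_(u \in D) (F u true + F u false).
Proof.
move=> finD; rewrite -pair_fsbig //; last exact: finite_finset.
apply: eq_fsbigr => u _.
have -> : [set: bool] = [set` [:: true; false]] by apply/seteqP; split=> // -[].
by rewrite -fsbig_seq // big_cons big_seq1.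
Qed.

Lemma fsbig_mulr (T : choiceType) (D : set T) (F : T -> A) c : finite_set D ->
  c * (\sum_(u \in D) F u) = \sum_(u \in D) c * F u.
Proof. by move=> finD; rewrite !fsbig_finite // mulr_sumr. Qed.

End PowerSeries.

(** * Weights of walks in the Laurent ring *)

Section Coefficients.
Variables (R : realType) (X : set vertex) (a : edge).
Hypotheses (hX : simple_domain X) (ha : border X a).
Local Notation z := (zeta R).
Local Notation L := (laurent R[i]).
Local Notation y := (laurentY R[i]).
Local Notation c0 := (ell_border R X a).

Definition weight (k : int) : L := (c0 * z ^ k) *: y ^ k.

Lemma scale_mul_scale (c d : R[i]) (f g : L) : (c *: f) * (d *: g) = (c * d) *: (f * g).
Proof. by rewrite -scalerAl -scalerAr scalerA. Qed.

(** By [zeta3], [z ^- 2] is [- z] and [z ^+ 2] is [- z^-1], so the exponents of z and y move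
    together by 1, up to a sign. *)
Lemma weight_hook k :
  (z ^- 2 *: y + z ^+ 2 *: y^-1) * weight k = - (weight (k + 1) + weight (k - 1)).
Proof.
have z0 := zeta_neq0 R; have y0 := laurentY_unit R[i].
have zV2 : z ^- 2 = - z.
  by apply: (mulfI (expf_neq0 2 z0));
    rewrite mulfV ?expf_neq0 // mulrN -exprSr zeta3 opprK.
have z2 : z ^+ 2 = - z^-1.
  by apply: (mulIf z0); rewrite -exprSr zeta3 mulNr mulVf.
rewrite /weight zV2 z2 mulrDl !scale_mul_scale !mulNr !scaleNr -opprD.
rewrite !expfzDr // !exprzDr // !expr1z !exprN1.
congr (- (_ *: _ + _ *: _)); solve [exact: mulrC | by rewrite mulrC -mulrA].
Qed.

(** The sixth power of z is 1, so [z ^+ 2] is [z ^ (- 4)] and [z ^- 2] is [z ^ 4]; again both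
    exponents move together. *)
Lemma weight_cycle k :
  (z ^+ 2 *: y ^- 4 + z ^- 2 *: y ^+ 4) * weight k = weight (k - 4) + weight (k + 4).
Proof.
have z0 := zeta_neq0 R; have y0 := laurentY_unit R[i].
have z4 : z ^- 2 = z ^ 4.
  apply: (mulfI (expf_neq0 2 z0)); rewrite mulfV ?expf_neq0 //.
  by rewrite -[z ^ 4]/(z ^+ 4) -exprD (exprM z 3 2) zeta3 sqrrN expr1n.
have z2 : z ^+ 2 = z ^ (- 4).
  by rewrite -invr_expz -z4 invrK.
rewrite /weight z4 z2 mulrDl !scale_mul_scale.
rewrite !expfzDr // !exprzDr //.
congr (_ *: _ + _ *: _); solve [exact: mulrC | exact: mulrCA | by rewrite mulrC -mulrA].
Qed.

Lemma ell_walk_weight w : walk w -> first_edge w = a -> ~ X (first_vertex w) ->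
  ell_walk R w *: y ^ winding w = weight (winding w).
Proof.
move=> wW wa wX; rewrite /weight; congr (_ *: _).
by rewrite ell_walkE // wa; have [_ ->] := first_edge_border ha wa wX.
Qed.

Lemma domain_paths_walksP n w e : (0 < n)%N ->
  (domain_walks X a e `&` [set w | walk_length w = n]) w <->
  (domain_paths X a n `&` [set w | final_edge w = e]) w.
Proof.
move=> n0; split=> [[hw wn]|[[wW wa wX sw wXi] we]].
  have [wW wa wX we wXi] := hw; have [/walkP[s1 _ _] _] := andP wW.
  move: wn; rewrite /= walk_lengthE => wn; split=> //; split=> //; first lia.
  by move=> i ik; apply: (domain_walks_in hw); rewrite walk_lengthE wn.
split; last by rewrite /= walk_lengthE sw.
split=> // i; rewrite sw => iw nX.
have [->|i0] := eqVneq i 0%N; [by left|right].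
have [->//|ne] := eqVneq i n; exfalso; apply: nX; apply: wXi; lia.
Qed.

(** The sign arises because a walk of length at least 2 leaves X through e: [ell_walk] orients e
    away from its outer endvertex, [ell_border] away from the inner one. *)
Lemma domain_walks_weight e w : border X e -> domain_walks X a e w ->
  (1 < walk_length w)%N ->
  ell_border R X e *: y ^ border_winding X a e = - weight (winding w).
Proof.
move=> he hw w1; have [/andP[wW _] wa wX we _] := hw.
rewrite (border_windingE ha he hX hw) -ell_walk_weight // -scaleNr; congr (_ *: _).
have [e1 e2] := domain_walks_last he hw w1.
rewrite /ell_walk we /final_vertex -walk_lengthE e2 /ell_border.
have [he' _] := he.
rewrite /inner_endvertex /outer_endvertex.
case: asboolP => _; apply: ell_opp; rewrite -?surjective_pairing; auto;
  by have := @adj_neq e.1 e.2; rewrite 1?eq_sym; apply;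
  rewrite /adj /edge_between -surjective_pairing he'.
Qed.

End Coefficients.

(** * The identity *)

Section Identity.
Variables (R : realType) (X : set vertex) (a : edge).
Hypotheses (hX : simple_domain X) (ha : border X a).
Local Notation z := (zeta R).
Local Notation L := (laurent R[i]).
Local Notation y := (laurentY R[i]).
Local Notation G := (weight R X a).
Local Notation x := (fpsX L).

Lemma domain_SAWs_of_lengthE n : (0 < n)%N ->
  domain_SAWs_of_length X a n =
  (domain_paths X a n `&` [set w | X (nv w n)]) `&` [set w | uniq w].
Proof.
move=> n0; apply/seteqP; split=> w.
  by move=> /domain_SAWs_ofE => /(_ n0)[].
by move=> [[wp wX] wU]; apply/domain_SAWs_ofE.
Qed.

Lemma looping_pathsE n :
  looping_paths X a n =
  (domain_paths X a n `&` [set w | X (nv w n)]) `&` ~` [set w | uniq w].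
Proof.
by apply/seteqP; split=> w; [move=> [? ? /negP]|move=> [[? ?] /negP]].
Qed.

Lemma domain_SAWs_of_length0 : domain_SAWs_of_length X a 0 = set0.
Proof.
apply/seteqP; split=> // w [[/andP[/walkP[w1 _ _] _] _ _ _]].
by rewrite /= walk_lengthE; lia.
Qed.

Lemma finite_domain_SAWs n : finite_set (domain_SAWs_of_length X a n).
Proof.
case: n => [|n]; first by rewrite domain_SAWs_of_length0.
rewrite domain_SAWs_of_lengthE //; do 2 apply: finite_setIl.
exact: finite_domain_paths.
Qed.

Lemma finite_looping n : finite_set (looping_paths X a n).
Proof.
by rewrite looping_pathsE; do 2 apply: finite_setIl; apply: finite_domain_paths.
Qed.

Lemma finite_tailed_cycles n : finite_set (tailed_cycles X a n).
Proof.
have [_ _ onto] := set_bij_split_loop n ha.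
apply: (@sub_finite_set _ _ (fst @` (split_loop @` looping_paths X a n))).
  by move=> p hp; exists (p, true) => //; apply: onto.
by do 2 apply: finite_image; apply: finite_looping.
Qed.

Lemma sum_extend n : (0 < n)%N ->
  \sum_(w \in domain_paths X a n.+1) G (winding w) =
  - ((z ^- 2 *: y + z ^+ 2 *: y^-1) *
     \sum_(w \in domain_SAWs_of_length X a n) G (winding w)).
Proof.
move=> n0; rewrite (reindex_fsbig _ _ _ _ (set_bij_extend X a n0)).
transitivity (\sum_(p \in domain_SAWs_of_length X a n `*` [set: bool])
    G (winding p.1 + if p.2 then 1 else - 1)).
  apply: eq_fsbigr => -[w b] /set_mem/= [[[/andP[wW _] _ _ _] sw] _].
  move: sw; rewrite /= walk_lengthE => sw; have [s1 wA _] := walkP _ wW.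
  rewrite winding_rcons // sw.
  have wa : adj (nv w n.-1) (nv w n).
    by have := wA n.-1; rewrite prednK //; apply; lia.
  by have [_ _ ->] := thirdP b wa.
rewrite (fsbig_bool (fun w (b : bool) => G (winding w + if b then 1 else - 1)));
  last exact: finite_domain_SAWs.
rewrite fsbig_mulr; last exact: finite_domain_SAWs.
rewrite !fsbig_finite; try exact: finite_domain_SAWs.
by rewrite -sumrN; apply: eq_bigr => w _; rewrite weight_hook opprK.
Qed.

Lemma sum_looping n :
  \sum_(w \in looping_paths X a n) G (winding w) =
  (z ^+ 2 *: y ^- 4 + z ^- 2 *: y ^+ 4) *
    \sum_(p \in tailed_cycles X a n) G (winding p.1).
Proof.
transitivity (\sum_(p \in tailed_cycles X a n `*` [set: bool])
    G (winding p.1.1 + if p.2 then - 4 else 4)).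
  rewrite (reindex_fsbig _ _ _ _ (set_bij_split_loop n ha)).
  by apply: eq_fsbigr => w /set_mem hw; rewrite (winding_split_loop hX hw).
rewrite (fsbig_bool (fun p (b : bool) => G (winding p.1 + if b then - 4 else 4)));
  last exact: finite_tailed_cycles.
rewrite fsbig_mulr; last exact: finite_tailed_cycles.
by apply: eq_fsbigr => p _; rewrite weight_cycle.
Qed.

(** The final vertex is in X and new, in X and visited before, or outside X. *)
Lemma sum_domain_paths n : (0 < n)%N ->
  \sum_(w \in domain_paths X a n) G (winding w) =
  \sum_(w \in domain_SAWs_of_length X a n) G (winding w) +
  \sum_(w \in looping_paths X a n) G (winding w) +
  \sum_(w \in domain_paths X a n `&` ~` [set w | X (nv w n)]) G (winding w).
Proof.
move=> n0; have fin := finite_domain_paths n ha.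
rewrite (fsbigID [set w | X (nv w n)]) //; congr (_ + _).
rewrite (fsbigID [set w | uniq w]); last exact: finite_setIl.
by rewrite domain_SAWs_of_lengthE // looping_pathsE.
Qed.

Lemma coef_border_sum n : (0 < n)%N ->
  fps_coef (\fps_sum_(e in border X)
     ((ell_border R X e *: y ^ border_winding X a e) *: walk_gf R X a e)) n =
  \sum_(e \in border X) \sum_(w \in domain_paths X a n `&` [set w | final_edge w = e])
     (ell_border R X e *: y ^ border_winding X a e).
Proof.
move=> n0 /=; apply: eq_fsbigr => e _.
transitivity ((ell_border R X e *: y ^ border_winding X a e) *
    \sum_(w \in domain_paths X a n `&` [set w | final_edge w = e]) (1 : L)).
  have <- : domain_walks X a e `&` [set w | walk_length w = n] =
      domain_paths X a n `&` [set w | final_edge w = e].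
    by apply/seteqP; split=> w /(domain_paths_walksP X a w e n0).
  congr (_ * _).
  rewrite -fsbig_length; apply: eq_fsbigr => w _.
  by rewrite mul1r -fps_coefXn.
rewrite fsbig_mulr; last by apply: finite_setIl; apply: finite_domain_paths.
by apply: eq_fsbigr => w _; rewrite mulr1.
Qed.

Lemma domain_paths1 w : domain_paths X a 1 w -> [/\ winding w = 0, final_edge w = a,
  domain_SAWs_of_length X a 1 w & domain_walks X a a w].
Proof.
move=> wp; have [/andP[wW _] wa wX sw _] := wp.
have fa : final_edge w = a.
  by rewrite -wa /final_edge /first_edge /first_vertex /final_vertex sw.
have hw : domain_walks X a a w.
  by have [] := (@domain_paths_walksP X a 1%N w a isT).2 (conj wp fa).
split=> //; first by rewrite windingE walk_lengthE sw /turning big_geq.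
have [w0 w1] := first_edge_border ha wa wX.
have [_ ha'] := ha.
have X1 : X (nv w 1).
  by rewrite w1 /inner_endvertex; case: asboolP => //; move: ha'; tauto.
apply/domain_SAWs_ofE => //; split=> //.
move: wX X1; rewrite /first_vertex; move: sw; case: (w) => [|u [|v []]] // _.
rewrite /= /nth_vertex /= inE andbT => nX Xv; apply/eqP => uv.
by apply: nX; rewrite uv.
Qed.

(** The walk along a alone belongs both to X(a, a) and to S. It enters X, so here both orientations
    agree and no sign appears. *)
Lemma coef_border_sum1 :
  fps_coef (\fps_sum_(e in border X)
     ((ell_border R X e *: y ^ border_winding X a e) *: walk_gf R X a e)) 1 =
  \sum_(w \in domain_SAWs_of_length X a 1) G (winding w).
Proof.
rewrite coef_border_sum //.
transitivity (\sum_(e \in border X) \sum_(w \in domain_paths X a 1 `&` [set w |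
  final_edge w = e])
     G (winding w)).
  apply: eq_fsbigr => e _; apply: eq_fsbigr => w /set_mem[wp /= we].
  have [w0 wa _ hw] := domain_paths1 wp; have ea : e = a by rewrite -we wa.
  by rewrite ea (border_windingE ha ha hX hw) w0 /weight expr0z mulr1.
rewrite fsbig_fibers; last exact: finite_domain_paths.
suff -> : domain_paths X a 1 `&` final_edge @^-1` border X = domain_SAWs_of_length
  X a 1 by [].
apply/seteqP; split=> w; first by move=> [/domain_paths1[]].
move=> /domain_SAWs_ofE => /(_ isT)[wp _ _]; split=> //=.
by have [_ -> _ _] := domain_paths1 wp.
Qed.

Lemma coef_border_sumS n : (0 < n)%N ->
  fps_coef (\fps_sum_(e in border X)
     ((ell_border R X e *: y ^ border_winding X a e) *: walk_gf R X a e)) n.+1 =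
  - \sum_(w \in domain_paths X a n.+1 `&` ~` [set w | X (nv w n.+1)]) G (winding w).
Proof.
move=> n0; rewrite coef_border_sum //.
transitivity (\sum_(e \in border X) \sum_(w \in domain_paths X a n.+1 `&` [set w |
  final_edge w = e])
     - G (winding w)).
  apply: eq_fsbigr => e /set_mem he; apply: eq_fsbigr => w /set_mem hw.
  have [hw' wn] := (domain_paths_walksP X a w e (ltn0Sn _)).2 hw.
  by apply: (domain_walks_weight _ hX ha he hw'); rewrite wn ltnS.
have fin := finite_domain_paths n.+1 ha.
rewrite fsbig_fibers //.
(* The vertex before the last is in X, so the final edge is a border edge exactly when the last
   vertex is outside X. *)
have -> : domain_paths X a n.+1 `&` final_edge @^-1` border X =
    domain_paths X a n.+1 `&` ~` [set w | X (nv w n.+1)].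
  apply/seteqP; split=> w [wp hw]; split=> //; move: hw;
    have [/andP[/walkP[s1 wA _] _] _ _ sw wXi] := wp;
      have Xn : X (nv w n) by apply: wXi; lia.
    rewrite /border /preimage /mkset /final_edge /final_vertex sw => -[_].
    by case: (edge_between_pair (nv w n) (nv w n.+1)) => -> [[]|[]].
  rewrite /border /preimage /mkset /final_edge /final_vertex sw => nX; split.
    by apply: wA; rewrite sw.
  by case: (edge_between_pair (nv w n) (nv w n.+1)) => ->; [left|right].
by rewrite !fsbig_finite ?sumrN //; apply: finite_setIl.
Qed.

Lemma coef_SAW_sum n :
  fps_coef (\fps_sum_(w in domain_SAWs X a)
     ((ell_walk R w *: y ^ winding w) *: x ^+ walk_length w)) n =
  \sum_(w \in domain_SAWs_of_length X a n) G (winding w).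
Proof.
rewrite /domain_SAWs_of_length -fsbig_length /=.
apply: eq_fsbigr => w /set_mem[/andP[wW _] wa wX _].
by rewrite (ell_walk_weight R ha) // fps_coefXn.
Qed.

Lemma coef_cycle_sum n :
  fps_coef (\fps_sum_(wC in [set wC : seq vertex * subgraph |
                      domain_SAWs X a wC.1 /\ tail_cycles X wC.1 wC.2])
       ((ell_walk R wC.1 *: y ^ winding wC.1) *:
          x ^+ (walk_length wC.1 + #|` wC.2.2|))) n =
  \sum_(p \in tailed_cycles X a n) G (winding p.1).
Proof.
have -> : tailed_cycles X a n = [set wC : seq vertex * subgraph |
    domain_SAWs X a wC.1 /\ tail_cycles X wC.1 wC.2] `&`
    [set p | (walk_length p.1 + #|` p.2.2|)%N = n].
  by apply/seteqP; split=> p; [move=> []|move=> [[]]].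
rewrite -fsbig_length /=.
apply: eq_fsbigr => -[w C] /set_mem[/= [/andP[wW _] wa wX _] _].
by rewrite (ell_walk_weight R ha) // fps_coefXn.
Qed.

End Identity.

Theorem proposition2 (R : realType) (X : set vertex) (a : edge)
    (hX : simple_domain X) (ha : border X a) :
  let x : fps (laurent R[i]) := fpsX (laurent R[i]) in
  let y : laurent R[i] := laurentY R[i] in
  let z : R[i] := zeta R in
  \fps_sum_(e in border X)
     ((ell_border R X e *: y ^ border_winding X a e) *: walk_gf R X a e) =
  (1 + (z ^- 2 *: y) *: x + (z ^+ 2 *: y^-1) *: x) *
    (\fps_sum_(w in domain_SAWs X a)
       ((ell_walk R w *: y ^ winding w) *: x ^+ walk_length w)) +
  (z ^+ 2 *: y ^- 4 + z ^- 2 *: y ^+ 4) *: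
    (\fps_sum_(wC in [set wC : seq vertex * subgraph |
                      domain_SAWs X a wC.1 /\ tail_cycles X wC.1 wC.2])
       ((ell_walk R wC.1 *: y ^ winding wC.1) *:
          x ^+ (walk_length wC.1 + #|` wC.2.2|))).
Proof.
move=> x y z; rewrite -addrA -scalerDl; apply/fpsP => n.
set BO := \fps_sum_(e in border X) _; set SW := \fps_sum_(w in domain_SAWs X a) _.
set CY := \fps_sum_(wC in _) _.
set c := z ^- 2 *: y + _; set d := z ^+ 2 *: y ^- 4 + _.
change (fps_coef BO n = fps_coef ((1 + c *: x) * SW) n + d * fps_coef CY n).
rewrite coef_cycle_sum // -sum_looping //.
have loop0 k : (k < 2)%N -> looping_paths X a k = set0.
  by move=> k2; apply/seteqP; split=> // w /loop_startP[]; lia.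
(* [sum_extend] concerns lengths from 2 on; the coefficients of x^0 and x^1 are compared
   directly. *)
case: n => [|[|n]].
- rewrite fps_coef0_linear_mul coef_SAW_sum // domain_SAWs_of_length0 loop0 //
  !fsbig_set0 addr0.
  rewrite /= fsbig1 // => e _.
  rewrite /walk_gf /= [X in _ * X]fsbig1 ?mulr0 // => w [/andP[/walkP[w1 _ _] _] _
    _ _ _].
  by rewrite fps_coefXn walk_lengthE; case: (size w) w1 => [|[]].
- rewrite coef_border_sum1 // fps_coef_linear_mul !coef_SAW_sum //
  domain_SAWs_of_length0.
  by rewrite loop0 // !fsbig_set0 mulr0 !addr0.
rewrite coef_border_sumS // fps_coef_linear_mul !coef_SAW_sum //.
(* This turns the shifted term into minus the sum over all walks of length [n.+2]; its split by
   [sum_domain_paths] cancels the walks of S and the looping ones, leaving those that exit X. *)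
have e := sum_extend R ha (ltn0Sn n); rewrite -/z -/y -/c in e.
rewrite -[c * _]opprK -e (sum_domain_paths R ha) // !opprD.
by rewrite !addrA subrr sub0r addrAC addNr add0r.
Qed.
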